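(* For every formed space $E$ and every $U\in\mathcal{P}^\omega(E)$, the poset $\mathcal{P}^\omega(E,U)$ is Cohen–Macaulay.
   Context: Formed spaces over a field $\mathbb{F}$ with involution $\sigma$ ($\bar c=\sigma(c)$), $\varepsilon$ ($\varepsilon\bar\varepsilon=1$) and additive subgroup $\Lambda$ with $\{c-\varepsilon\bar c\}\le\Lambda\le\{c:c+\varepsilon\bar c=0\}$: a form on a finite-dimensional $E$ is a sesquilinear $f$ ($f(av,bw)=\bar af(v,w)b$) modulo those with $f(v,v)\in\Lambda$, $f(w,v)=-\varepsilon\overline{f(v,w)}$. $\omega_q(v,w)=q(v,w)+\varepsilon\overline{q(w,v)}$, $Q_q(v)=q(v,v)+\Lambda$; $K(E)=\{v:\omega_q(E,v)=0\}$, radical $R(E)=\{v\in K(E):Q_q(v)=0\}$; $U^\perp=\{v:\omega_q(v,U)=0\}$; isotropic means $\omega_q,Q_q$ vanish on the subspace. $\mathcal{P}^\omega(E)$ is the poset (inclusion) of isotropic $W$ with $R(E)<W<E$, and $\mathcal{P}^\omega(E,U)=\{W\in\mathcal{P}^\omega(E):W+U^\perp=E\}$. A graded poset is Cohen–Macaulay if for all $-\infty\le x\le y\le\infty$ the interval $(x,y)=\{z:x<z<y\}$ has $(\dim(x,y)-1)$-connected realization, $\dim$ being maximal chain length. *)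

(* Defs.v *)
From HB Require Import structures.
From mathcomp Require Import all_boot all_order all_algebra.
From mathcomp Require Import all_classical all_reals all_analysis.
From mathcomp Require Import Rstruct Rstruct_topology.

Set Implicit Arguments.
Unset Strict Implicit.
Unset Printing Implicit Defensive.

Import Order.TTheory GRing.Theory Num.Theory.
Local Open Scope ring_scope.
Local Open Scope classical_set_scope.

(* A poset is given by a carrier T, an order relation le on T, and a   *)
(* subset S of T (the elements of the poset).                          *)

Notation RR := Rdefinitions.R.

Section Posets.
Variables (T : eqType) (le : rel T).

Definition plt (a b : T) : bool := le a b && (a != b).

(* a chain of the poset S : a strictly increasing finite sequence in S;
   its length (as a chain) is size c - 1. *)
Definition is_chain (S : set T) (c : seq T) : Prop :=
  sorted plt c /\ (forall t, t \in c -> S t).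

Definition is_maxchain (S : set T) (c : seq T) : Prop :=
  is_chain S c /\
  (forall c', is_chain S c' -> {subset c <= c'} -> {subset c' <= c}).

(* dim S = d : maximal length of a chain (d = -1 for the empty poset) *)
Definition has_dim (S : set T) (d : int) : Prop :=
  (exists c, is_chain S c /\ (size c)%:Z = d + 1) /\
  (forall c, is_chain S c -> (size c)%:Z <= d + 1).

Definition graded (S : set T) : Prop :=
  exists d, has_dim S d /\ forall c, is_maxchain S c -> (size c)%:Z = d + 1.

(* Geometric realization of the order complex of S: points are
   functions alpha : T -> R, nonnegative, supported on a chain of S,
   with coordinates summing to 1. *)
Definition realization (S : set T) : set (T -> RR) :=
  [set alpha | exists c, [/\ is_chain S c,
     forall t, t \notin c -> alpha t = 0,
     forall t, 0 <= alpha t & \sum_(t <- c) alpha t = 1]].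

Definition std_simplex (n : nat) : set 'rV[RR]_n :=
  [set l | (forall i, 0 <= l ord0 i) /\ \sum_(i < n) l ord0 i = 1].
Arguments std_simplex n : clear implicits.

(* the characteristic (barycentric) map of the simplex spanned by c *)
Definition bary (c : seq T) (l : 'rV[RR]_(size c)) : T -> RR :=
  fun t => \sum_(i < size c | nth t c i == t) l ord0 i.
Arguments bary c l : clear implicits.

(* coherent (weak) topology on the realization: O is open iff its trace
   on every closed simplex is open in that simplex *)
Definition coh_open (S : set T) (O : set (T -> RR)) : Prop :=
  forall c, is_chain S c ->
    exists V : set 'rV[RR]_(size c), open V /\
      std_simplex (size c) `&` (bary c @^-1` O) = std_simplex (size c) `&` V.

Definition cont_into (S : set T) (m : nat) (A : set 'rV[RR]_m)
  (f : 'rV[RR]_m -> T -> RR) : Prop :=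
  (forall x, A x -> realization S (f x)) /\
  (forall O, coh_open S O ->
     exists V : set 'rV[RR]_m, open V /\ A `&` (f @^-1` O) = A `&` V).

Definition sphere (n : nat) : set 'rV[RR]_n.+1 :=
  [set x | \sum_(i < n.+1) x ord0 i ^+ 2 = 1].
Definition ball_closed (n : nat) : set 'rV[RR]_n.+1 :=
  [set x | \sum_(i < n.+1) x ord0 i ^+ 2 <= 1].
Arguments sphere n : clear implicits.
Arguments ball_closed n : clear implicits.

(* |S| is k-connected (k : int, k >= -1 meaningful): nonempty if
   k >= -1, and every continuous map S^n -> |S| with n <= k extends
   to a continuous map D^(n+1) -> |S|.  For k <= -2 no condition. *)
Definition k_connected (S : set T) (k : int) : Prop :=
  (-1 <= k -> exists alpha, realization S alpha) /\
  (forall n : nat, (n%:Z <= k) ->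
     forall f, cont_into S (sphere n) f ->
       exists g, cont_into S (ball_closed n) g /\
                 (forall x, sphere n x -> g x = f x)).

Inductive ext := Bot | Mid of T | Top.

Definition ext_le (x y : ext) : Prop :=
  match x, y with
  | Bot, _ => True
  | _, Top => True
  | Mid a, Mid b => le a b
  | _, _ => False
  end.

Definition ext_lt (x y : ext) : Prop := ext_le x y /\ x <> y.

Definition in_ext (S : set T) (x : ext) : Prop :=
  match x with Mid a => S a | _ => True end.

Definition open_interval (S : set T) (x y : ext) : set T :=
  [set z | S z /\ ext_lt x (Mid z) /\ ext_lt (Mid z) y].

Definition cohen_macaulay (S : set T) : Prop :=
  graded S /\
  forall x y : ext, in_ext S x -> in_ext S y -> ext_le x y ->
    exists d, has_dim (open_interval S x y) d /\
              k_connected (open_interval S x y) (d - 1).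

End Posets.

Section Formed.
Variables (F : fieldType) (E : vectType F).
Variables (sigma : {rmorphism F -> F}) (eps : F) (Lambda : pred F).

Definition form_parameters : Prop :=
  [/\ involutive sigma, eps * sigma eps = 1,
      (forall a b, a \in Lambda -> b \in Lambda -> a - b \in Lambda),
      (forall c, c - eps * sigma c \in Lambda) &
      (forall c, c \in Lambda -> c + eps * sigma c = 0)].

Definition sesquilinear (q : E -> E -> F) : Prop :=
  [/\ forall v v' w, q (v + v') w = q v w + q v' w,
      forall v w w', q v (w + w') = q v w + q v w' &
      forall a b v w, q (a *: v) (b *: w) = sigma a * q v w * b].

Variable q : E -> E -> F.

Definition omega (v w : E) : F := q v w + eps * sigma (q w v).

(* Q_q(v) = 0 in F / Lambda *)
Definition Qzero (v : E) : Prop := q v v \in Lambda.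

Definition Kset (v : E) : Prop := forall u, omega u v = 0.
Definition Rad (v : E) : Prop := Kset v /\ Qzero v.

Definition perp (U : {vspace E}) (v : E) : Prop :=
  forall u, u \in U -> omega v u = 0.

Definition isotropic (W : {vspace E}) : Prop :=
  (forall v w, v \in W -> w \in W -> omega v w = 0) /\
  (forall v, v \in W -> Qzero v).

Definition Pomega (W : {vspace E}) : Prop :=
  [/\ isotropic W,
      (forall v, Rad v -> v \in W),
      (exists2 w, w \in W & ~ Rad w) &
      W <> fullv].

Definition PomegaU (U : {vspace E}) (W : {vspace E}) : Prop :=
  Pomega W /\
  forall e : E, exists w x, [/\ w \in W, perp U x & e = w + x].

End Formed.

Definition vsub_le (F : fieldType) (E : vectType F) : rel {vspace E} :=
  fun A B => (A <= B)%VS.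

(* Main.v *)
Require Import Defs.
From HB Require Import structures.
From mathcomp Require Import all_boot all_order all_algebra.
From mathcomp Require Import all_classical all_reals all_analysis.
From mathcomp Require Import Rstruct_topology zify ring lra.

Set Implicit Arguments.
Unset Strict Implicit.
Unset Printing Implicit Defensive.

Import Order.TTheory GRing.Theory Num.Theory numFieldNormedType.Exports.
Local Open Scope ring_scope.
Local Open Scope classical_set_scope.

(** Attaching to a flag complex [X] cones over [(k - 1)]-connected subcomplexes preserves
    [k]-connectivity. Indeed, view a map of a sphere of dimension at most [k] as a map on the
    boundary of a cube, subdivided into a grid so fine that a cell meets the star of at most
    one cone point, and push it off the cone points that it only grazes; it then extends to
    the cube cell by cell, inside the star of the cone point on the cells that meet one, in
    the link of that point on their faces, and in [X] elsewhere. All intervals of the poset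
    are built in this way from cones.

    Modulo the radical, an isotropic [W] belongs to the poset iff no nonzero vector of [U] is
    orthogonal to [W]. Induct on [dim U]: write [U = U' + <z>] and choose an isotropic [w]
    orthogonal to [U'] with [omega z w <> 0]. The [W] containing [w] form the poset of [U']
    in [w^perp / w]. The [W] such that [W :&: w^perp] is still in the poset deform to them.
    For any other [W] there is a unique [y] in [w + U] different from [w] and orthogonal to
    [W]. These [W] are attached in two rounds: first, by increasing dimension, those which
    do not contain [y], along the join of the [W'] below [W] (supplements of [W :&: U^perp]
    in [W]) with the [W'] above [W] which are not orthogonal to [y], an instance of the same
    problem for a single, possibly anisotropic, vector; then, by decreasing dimension, those
    which contain [y], along the join of the supplements avoiding [y] with all isotropic
    subspaces above [W]. *)

(** * Families of points in a flag complex *)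

Section Continuity.
Variables (X Y Z : topologicalType).

Lemma within_continuous_compS (A : set X) (B : set Y) (f : X -> Y) (g : Y -> Z) :
  (forall x, A x -> B (f x)) ->
  {within A, continuous f} -> {within B, continuous g} -> {within A, continuous (g \o f)}.
Proof.
move=> AB; rewrite !subspace_continuousP => cf cg x Ax.
apply: cvg_comp (cg _ (AB _ Ax)) => P /(cf x Ax).
by rewrite !nbhs_filterE; apply: (@filterS _ (nbhs x)) => y BP Ay; exact: BP Ay (AB _ Ay).
Qed.

Lemma within_continuous_bigsetU (I : Type) (r : seq I) (P : pred I) (A : I -> set X)
    (f : X -> Y) :
  (forall i, P i -> closed (A i)) -> (forall i, P i -> {within A i, continuous f}) ->
  {within \big[setU/set0]_(i <- r | P i) A i, continuous f}.
Proof.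
move=> cA cf; suff [] : closed (\big[setU/set0]_(i <- r | P i) A i) /\
  {within \big[setU/set0]_(i <- r | P i) A i, continuous f} by [].
elim/big_rec: _ => [|i B Pi [cB fB]]; first by split; [exact: closed0|exact: continuous_subspace0].
by split; [exact: closedU (cA _ Pi) cB|apply: withinU_continuous fB; [exact: cA| |exact: cf]].
Qed.

End Continuity.

Section UniformContinuity.
Variables (R : realType) (V W : pseudoMetricNormedZmodType R).

Lemma compact_uniformly_continuous (K : set V) (f : V -> W) : compact K ->
  {within K, continuous f} -> forall e, 0 < e ->
  \forall d \near 0^'+, forall x, K x -> forall y, K y -> `|x - y| < d -> `|f x - f y| < e.
Proof.
move=> /compact_near_coveringP cK; rewrite subspace_continuousP => cf e e0.
have e20 : 0 < e / 2 by rewrite divr_gt0.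
suff : \forall d \near 0^'+, K `<=` [set x | K x -> forall y, K y -> `|x - y| < d ->
  `|f x - f y| < e] by apply: filterS => d near_d x Kx; exact: near_d.
apply: cK => x Kx; have /cvgrPdist_lt/(_ _ e20)/nbhs_ballP[d /= d0 near_x] := cf x Kx.
exists (ball x (d / 2), [set d' | d' < d / 2]).
  by split=> /=; [apply: nbhsx_ballx|apply: nbhs_right_lt]; rewrite divr_gt0.
move=> [x' d'] /= []; rewrite -ball_normE /= => xx' d'd Kx' y Ky x'y.
have fx z : K z -> `|x - z| < d -> `|f x - f z| < e / 2.
  by move=> Kz xz; apply: near_x => //; rewrite -ball_normE.
rewrite (splitr e) -(subrK (f x) (f x')) -addrA.
apply: le_lt_trans (ler_normD _ _) (ltrD _ _).
  by rewrite distrC fx // (lt_trans xx') // ltr_pdivrMr // ltr_pMr // ltr1n.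
apply: fx => //; rewrite -(subrK x' x) -addrA (splitr d).
by apply: le_lt_trans (ler_normD _ _) (ltrD _ (lt_trans x'y d'd)).
Qed.

End UniformContinuity.

Section FlagComplex.
Variables (R : realType) (T : eqType) (cmp : rel T).
Hypotheses (cmpxx : reflexive cmp) (cmpC : symmetric cmp).
Implicit Types (S : set T) (s : seq T) (a b : T -> R).

(* Barycentric coordinates of a point in the complex of the finite cliques of [S],
   with all the vertices involved in [s]. *)
Definition flag_point S s a : Prop :=
  [/\ forall t, 0 <= a t, forall t, a t != 0 -> t \in s /\ S t,
      forall t u, a t != 0 -> a u != 0 -> cmp t u & \sum_(t <- undup s) a t = 1].

Definition flag_map (X : topologicalType) S (A : set X) (f : X -> T -> R) : Prop :=
  exists2 s, (forall x, A x -> flag_point S s (f x)) &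
    forall t, {within A, continuous (f^~ t)}.

Lemma sum_undup_support s s' a : (forall t, a t != 0 -> (t \in s) = (t \in s')) ->
  \sum_(t <- undup s) a t = \sum_(t <- undup s') a t.
Proof.
move=> ss'; pose supp t := a t != 0.
have sumE r : \sum_(t <- r) a t = \sum_(t <- r | supp t) a t.
  by rewrite [in RHS]big_rmcond // => t; rewrite negbK => /eqP.
rewrite !sumE -[LHS]big_filter -[RHS]big_filter; apply: perm_big.
apply: uniq_perm; rewrite ?filter_uniq ?undup_uniq // => t.
by rewrite !mem_filter !mem_undup; case: (boolP (supp t)) => // /ss' ->.
Qed.

Lemma flag_point_sub S S' s s' a : S `<=` S' -> {subset s <= s'} ->
  flag_point S s a -> flag_point S' s' a.
Proof.
move=> SS' ss' [a0 aS acmp asum]; split=> //.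
  by move=> t /aS[ts St]; split; [exact: ss'|exact: SS'].
by rewrite -asum; apply: sum_undup_support => t /aS[ts _]; rewrite ts ss'.
Qed.

Lemma flag_point_vertex S v : S v -> flag_point S [:: v] (fun t => (t == v)%:R).
Proof.
move=> Sv; split=> [t|t|t u|]; first by rewrite ler0n.
- by rewrite inE; case: (eqVneq t v) => [->|]; rewrite ?eqxx.
- case: (eqVneq t v) => [->|_]; last by rewrite eqxx.
  by case: (eqVneq u v) => [->|_]; rewrite ?eqxx.
- by rewrite big_seq1 eqxx.
Qed.

Lemma flag_point_segment S s a b (r : R) : 0 <= r <= 1 -> flag_point S s a ->
  flag_point S s b -> (forall t u, a t != 0 -> b u != 0 -> cmp t u) ->
  flag_point S s (fun t => (1 - r) * a t + r * b t).
Proof.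
move=> /andP[r0 r1] [a0 aS acmp asum] [b0 bS bcmp bsum] abcmp.
have nz t : (1 - r) * a t + r * b t != 0 -> a t != 0 \/ b t != 0.
  have [->|] := eqVneq (a t) 0; last by left.
  by have [->|] := eqVneq (b t) 0; [rewrite !mulr0 addr0 eqxx|right].
split=> [t|t /nz[/aS|/bS]//|t u|].
- by rewrite addr_ge0 // mulr_ge0 // subr_ge0.
- by move=> /nz[at0|bt0] /nz[au0|bu0]; [exact: acmp|exact: abcmp|rewrite cmpC abcmp|exact: bcmp].
- by rewrite big_split /= -!mulr_sumr asum bsum !mulr1 subrK.
Qed.

Section FlagMap.
Variable X : topologicalType.
Implicit Types (A B : set X) (f g : X -> T -> R).

Lemma flag_map_sub S S' A B f : S `<=` S' -> B `<=` A -> flag_map S A f -> flag_map S' B f.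
Proof.
move=> SS' BA [s fs cf]; exists s => [x /BA/fs|t]; first exact: flag_point_sub.
exact: continuous_subspaceW (cf t).
Qed.

Lemma eq_flag_map S A f g : (forall x, A x -> f x = g x) -> flag_map S A f -> flag_map S A g.
Proof.
move=> fg [s fs cf]; exists s => [x Ax|t]; first by rewrite -fg //; exact: fs.
by apply: subspace_eq_continuous (cf t) => x /set_mem Ax; rewrite /from_subspace fg.
Qed.

Lemma flag_map_vertex S A v : S v -> flag_map S A (fun _ t => (t == v)%:R).
Proof.
exists [:: v] => [x _|t]; first exact: flag_point_vertex.
by apply: continuous_subspaceT => x; exact: cvg_cst.
Qed.

Lemma flag_map_segment S A f g (r : X -> R) : flag_map S A f -> flag_map S A g ->
  (forall x, A x -> forall t u, f x t != 0 -> g x u != 0 -> cmp t u) ->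
  {within A, continuous r} -> (forall x, A x -> 0 <= r x <= 1) ->
  flag_map S A (fun x t => (1 - r x) * f x t + r x * g x t).
Proof.
move=> [s fs cf] [s' gs cg] fg cr r01; exists (s ++ s') => [x Ax|t x].
  apply: flag_point_segment; [exact: r01| | |exact: fg].
    by apply: flag_point_sub (fs x Ax) => // t ts; rewrite mem_cat ts.
  by apply: flag_point_sub (gs x Ax) => // t ts; rewrite mem_cat ts orbT.
apply: cvgD; apply: cvgM; [|exact: cf|exact: cr|exact: cg].
by apply: cvgB; [exact: cvg_cst|exact: cr].
Qed.

Lemma flag_map_bigsetU S (I : choiceType) (r : seq I) (P : pred I) (A : I -> set X) f :
  (forall i, P i -> closed (A i)) -> (forall i, P i -> flag_map S (A i) f) ->
  flag_map S (\big[setU/set0]_(i <- r | P i) A i) f.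
Proof.
move=> cA fA.
have /choice[s fs] i : exists s, P i -> forall x, A i x -> flag_point S s (f x).
  by case: (boolP (P i)) => [/fA[s]|_]; [exists s|exists [::]].
exists (flatten (map s r)) => [x|t]; last first.
  by apply: within_continuous_bigsetU => // i /fA[].
rewrite -bigcup_seq_cond => -[i /= /andP[ir Pi] Ax].
by apply: flag_point_sub (fs i Pi x Ax) => // t ts; apply/flattenP; exists (s i); rewrite ?map_f.
Qed.

Lemma flag_mapU S A B f : closed A -> closed B -> flag_map S A f -> flag_map S B f ->
  flag_map S (A `|` B) f.
Proof.
move=> cA cB fA fB; pose AB (i : bool) := if i then A else B.
have := @flag_map_bigsetU S bool [:: true; false] xpredT AB f.
by rewrite big_cons big_seq1; apply; case.
Qed.

End FlagMap.

Lemma flag_map_comp (X Y : topologicalType) S (A : set X) (B : set Y) (u : Y -> X)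
    (f : X -> T -> R) :
  (forall y, B y -> A (u y)) -> {within B, continuous u} -> flag_map S A f ->
  flag_map S B (f \o u).
Proof.
move=> BA cu [s fs cf]; exists s => [y /BA/fs//|t].
exact: (within_continuous_compS BA cu (cf t)).
Qed.

Lemma flag_map_uniformly_continuous (V : pseudoMetricNormedZmodType R) S (K : set V) f :
  compact K -> flag_map S K f -> forall e, 0 < e -> exists2 d, 0 < d &
    forall x y, K x -> K y -> `|x - y| < d -> forall t, `|f x t - f y t| < e.
Proof.
move=> cK [s fs cf] e e0.
have /filter_forall near_s (i : 'I_(size s)) :=
  compact_uniformly_continuous cK (cf (tnth (in_tuple s) i)) e0.
have [d [d0 near_d]] := filter_ex (filterI (nbhs_right_gt 0) near_s).
exists d => // x y Kx Ky xy t; have [/seq_tnthP[i ->]|ts] := boolP (t \in s); first exact: near_d.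
have out z : K z -> f z t = 0.
  by move=> /fs[_ fS _ _]; apply: contraNeq ts => /fS[].
by rewrite !out // subrr normr0.
Qed.

End FlagComplex.

(** * Extension of maps from the boundary of a cube *)

Section Rescaling.
Variables (R : realType) (V : normedModType R).
Implicit Types (c x : V) (r : R).

Lemma norm_sub_continuous c : continuous (fun x => `|x - c|).
Proof. by move=> x; apply: cvg_norm; apply: cvgB; [exact: cvg_id|exact: cvg_cst]. Qed.

Lemma closed_preimage_norm_sub c (D : set R) : closed D -> closed [set x | D `|x - c|].
Proof.
by move=> cD; apply: (@preimage_closed _ _ (fun x => `|x - c|) D) cD => x _;
  exact: norm_sub_continuous.
Qed.

Definition rescale c r c' r' x : V := c' + (r' / r) *: (x - c).

Lemma rescale_id c r x : r != 0 -> rescale c r c r x = x.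
Proof. by move=> r0; rewrite /rescale divff // scale1r addrC subrK. Qed.

Lemma rescaleK c r c' r' : r != 0 -> r' != 0 ->
  cancel (rescale c r c' r') (rescale c' r' c r).
Proof.
move=> r0 r'0 x; rewrite /rescale (addrC c') addrK scalerA mulrA divfK // divff // scale1r.
by rewrite addrC subrK.
Qed.

Lemma rescale_norm c r c' r' x : 0 < r -> 0 <= r' ->
  `|rescale c r c' r' x - c'| = r' / r * `|x - c|.
Proof.
by move=> r0 r'0; rewrite addrC addKr normrZ ger0_norm // divr_ge0 // ltW.
Qed.

Lemma rescale_continuous (A : set V) c c' r' (r : V -> R) :
  (forall x, A x -> r x != 0) -> {within A, continuous r} ->
  {within A, continuous (fun x => rescale c (r x) c' r' x)}.
Proof.
move=> r0 cr; rewrite continuous_subspace_in => x /set_mem Ax.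
have idA : {within A, continuous (@id V)} by apply: continuous_subspaceT => y; exact: cvg_id.
apply: cvgD; first exact: cvg_cst.
apply: cvgZ; last by apply: cvgB; [exact: idA|exact: cvg_cst].
by apply: cvgM; [exact: cvg_cst|apply: cvgV; [exact: r0|exact: cr]].
Qed.

End Rescaling.

Section Cubes.
Variables (R : realType) (N : nat).
Implicit Types (D : {set 'I_N}) (c x : 'rV[R]_N) (r : R).

Lemma rV_norm_leP x r : 0 <= r -> reflect (forall i, `|x 0 i| <= r) (`|x| <= r).
Proof.
move=> r0; rewrite -[`|x|]/(mx_norm x) mx_normrE.
apply: (iffP (bigmax_leP _ _ _ _)) => [[_ xr] i|xr].
  exact: (xr (0, i)).
by split=> // -[j i] _; rewrite (ord1 j); exact: xr.
Qed.

Lemma rV_norm_ltP x r : 0 < r -> reflect (forall i, `|x 0 i| < r) (`|x| < r).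
Proof.
move=> r0; rewrite -[`|x|]/(mx_norm x) mx_normrE.
apply: (iffP (bigmax_ltP _ _ _ _)) => [[_ xr] i|xr].
  exact: (xr (0, i)).
by split=> // -[j i] _; rewrite (ord1 j); exact: xr.
Qed.

Lemma rV_norm_attained x : x != 0 -> exists i, `|x| = `|x 0 i|.
Proof.
move=> x0; have [|[j i] xE] := @mx_norm_neq0 _ _ _ x.
  by rewrite -[mx_norm x]/(`|x|) normr_eq0.
by exists i; rewrite -[LHS]/(mx_norm x) xE (ord1 j).
Qed.

Definition flat D c : set 'rV[R]_N := [set x | forall i, i \notin D -> x 0 i = c 0 i].
Definition cube D c r : set 'rV[R]_N := [set x | `|x - c| <= r] `&` flat D c.
Definition cube_boundary D c r : set 'rV[R]_N := [set x | `|x - c| = r] `&` flat D c.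

Lemma cube_boundary_sub D c r : cube_boundary D c r `<=` cube D c r.
Proof. by move=> x [/= xr xc]; split=> //=; rewrite xr. Qed.

Lemma flat_closed D c : closed (flat D c).
Proof.
have -> : flat D c = \bigcap_(i in [set i | i \notin D]) (fun x => x 0 i) @^-1` [set c 0 i].
  by apply/seteqP; split.
apply: closed_bigI => i _; apply: preimage_closed => [x _|]; last exact: closed_eq.
exact: coord_continuous.
Qed.

Lemma cube_closed D c r : closed (cube D c r).
Proof.
by apply: closedI (@flat_closed D c); exact: (@closed_preimage_norm_sub _ _ c _ (@closed_le _ r)).
Qed.

Lemma cube_boundary_compact D c r : compact (cube_boundary D c r).
Proof.
apply: bounded_closed_compact.
  exists (`|c| + r); split; first exact: num_real.
  move=> M rM x [/= xr _]; apply: le_trans (ltW rM).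
  by rewrite -(subrK c x) addrC -xr ler_normD.
by apply: closedI (@flat_closed D c); exact: (@closed_preimage_norm_sub _ _ c _ (@closed_eq _ r)).
Qed.

Lemma rescale_flat D c r c' r' x : flat D c x -> flat D c' (rescale c r c' r' x).
Proof. by move=> xc i iD; rewrite !mxE xc // subrr mulr0 addr0. Qed.

Lemma rescale_cube D c r c' r' x : 0 < r -> 0 <= r' -> cube D c r x ->
  cube D c' r' (rescale c r c' r' x).
Proof.
move=> r0 r'0 [/= xr xc]; split; last exact: rescale_flat.
by rewrite /= rescale_norm // mulrAC ler_pdivrMr // ler_wpM2l.
Qed.

Lemma rescale_boundary D c r c' r' x : 0 < r -> 0 <= r' -> cube_boundary D c r x ->
  cube_boundary D c' r' (rescale c r c' r' x).
Proof.
move=> r0 r'0 [/= xr xc]; split; last exact: rescale_flat.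
by rewrite /= rescale_norm // xr divfK // gt_eqF.
Qed.

End Cubes.

Section Filling.
Variables (R : realType) (T : eqType) (cmp : rel T).
Hypotheses (cmpxx : reflexive cmp) (cmpC : symmetric cmp).
Implicit Types (S : set T) (r : R).

Definition extendable N S (D : {set 'I_N}) (c : 'rV[R]_N) r (f : 'rV[R]_N -> T -> R) : Prop :=
  exists2 g, flag_map cmp S (cube D c r) g & forall x, cube_boundary D c r x -> g x = f x.

Definition fills j S : Prop := forall N (D : {set 'I_N}) (c : 'rV[R]_N) r f,
  #|D| = j -> 0 < r -> flag_map cmp S (cube_boundary D c r) f -> extendable S D c r f.

Lemma extendable_rescale N S (D : {set 'I_N}) c r c' r' f : 0 < r -> 0 < r' ->
  extendable S D c' r' (f \o rescale c' r' c r) -> extendable S D c r f.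
Proof.
move=> r0 r'0 [g gS gf]; exists (g \o rescale c r c' r').
  apply: flag_map_comp gS => [x|]; first by apply: rescale_cube => //; exact: ltW.
  apply: rescale_continuous => [x _|]; first by rewrite gt_eqF.
  by apply: continuous_subspaceT; exact: cst_continuous.
move=> x xD; rewrite /= gf /= ?rescaleK ?gt_eqF //.
by apply: rescale_boundary => //; exact: ltW.
Qed.

Definition shell N (D : {set 'I_N}) (c : 'rV[R]_N) r : set 'rV[R]_N :=
  cube D c r `&` [set x | r / 2 <= `|x - c|].

Lemma shell_closed N (D : {set 'I_N}) (c : 'rV[R]_N) r : closed (shell D c r).
Proof.
by apply: closedI; [exact: cube_closed|exact: (@closed_preimage_norm_sub _ _ c _ (@closed_ge _ _))].
Qed.

Lemma cube_shell N (D : {set 'I_N}) (c : 'rV[R]_N) r : 0 <= r ->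
  cube D c r = shell D c r `|` cube D c (r / 2).
Proof.
move=> r0; apply/seteqP; split=> x; last by case=> [[]//|[/= xr xc]]; split=> //=; lra.
by move=> [/= xr xc]; case: (leP (r / 2) `|x - c|) => rx; [left|right; split=> //; exact: ltW].
Qed.

Lemma flag_map_shell N S (D : {set 'I_N}) c r (f : 'rV[R]_N -> T -> R) : 0 < r ->
  flag_map cmp S (cube_boundary D c r) f ->
  flag_map cmp S (shell D c r) (fun x => f (rescale c `|x - c| c r x)).
Proof.
move=> r0; have shell_gt0 x : shell D c r x -> 0 < `|x - c|.
  by move=> [_]; apply: lt_le_trans; rewrite divr_gt0.
apply: flag_map_comp => [x xS|].
  by apply: rescale_boundary; [exact: shell_gt0|exact: ltW|case: xS => [[]]].
apply: rescale_continuous => [x /shell_gt0|]; first by case: ltgtP.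
by apply: continuous_subspaceT; exact: norm_sub_continuous.
Qed.

(* The linear homotopy from [f'] to [f] lives on the outer half of the cube, and the
   extension of [f'] on the inner half. *)
Lemma extendable_homotopic N S (D : {set 'I_N}) c r f f' : 0 < r ->
  flag_map cmp S (cube_boundary D c r) f -> flag_map cmp S (cube_boundary D c r) f' ->
  (forall x, cube_boundary D c r x -> forall t u, f' x t != 0 -> f x u != 0 -> cmp t u) ->
  extendable S D c r f' -> extendable S D c r f.
Proof.
move=> r0 fS f'S ff' [g gS gf']; have r20 : 0 < r / 2 by rewrite divr_gt0.
pose proj x := rescale c `|x - c| c r x; pose s x := 2 / r * `|x - c| - 1.
pose h x t := (1 - s x) * f' (proj x) t + s x * f (proj x) t.
pose G x := if r / 2 <= `|x - c| then h x else g (rescale c (r / 2) c r x).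
have sE x : s x = (`|x - c| - r / 2) / (r / 2) by rewrite /s; field; rewrite gt_eqF.
have G_outer : flag_map cmp S (shell D c r) G.
  apply: (@eq_flag_map _ _ _ _ _ _ h) => [x [_ /= rx]|]; first by rewrite /G rx.
  apply: flag_map_segment; [exact: cmpC|exact: flag_map_shell|exact: flag_map_shell| | |].
  - move=> x [[/= xr xc] /= rx] t u; apply: ff'; apply: rescale_boundary => //.
      exact: lt_le_trans rx.
    exact: ltW.
  - move=> x; apply: cvgB; last exact: cvg_cst.
    apply: cvgM; first exact: cvg_cst.
    by apply: continuous_subspaceT; exact: norm_sub_continuous.
  - move=> x [[/= xr _] /= rx]; rewrite sE; apply/andP; split.
      by rewrite divr_ge0 ?subr_ge0 // ltW.
    by rewrite ler_pdivrMr // mul1r lerBlDr -splitr.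
have G_inner : flag_map cmp S (cube D c (r / 2)) G.
  apply: (@eq_flag_map _ _ _ _ _ _ (g \o rescale c (r / 2) c r)) => [x [/= xr xc]|]; last first.
    apply: flag_map_comp gS => [x|]; first by apply: rescale_cube => //; exact: ltW.
    apply: rescale_continuous => [x _|]; first by rewrite gt_eqF.
    by apply: continuous_subspaceT; exact: cst_continuous.
  rewrite /G; case: (leP (r / 2) `|x - c|) => // rx.
  have {rx}xr : `|x - c| = r / 2 by apply/eqP; rewrite eq_le xr.
  rewrite /h sE xr subrr mul0r subr0 /proj xr; apply/funext => t.
  by rewrite mul1r mul0r addr0 gf' //; apply: rescale_boundary => //; exact: ltW.
exists G => [|x [/= xr xc]].
  rewrite cube_shell; last exact: ltW.
  by apply: flag_mapU => //; [exact: shell_closed|exact: cube_closed].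
have sx : s x = 1 by rewrite /s xr divfK ?gt_eqF //; ring.
rewrite /G xr; have -> : r / 2 <= r by lra.
by apply/funext => t; rewrite /h sx subrr mul0r add0r mul1r /proj xr rescale_id // gt_eqF.
Qed.

Lemma cone_fills j S v : S v -> (forall s, S s -> cmp s v) -> fills j S.
Proof.
move=> Sv vS N D c r f _ r0 fS; have vertexS := @flag_map_vertex R _ _ cmpxx.
apply: (extendable_homotopic (f' := fun _ t => (t == v)%:R)) => //.
- exact: vertexS.
- move=> x xb t u; case: (eqVneq t v) => [->|]; rewrite ?eqxx // => _ fu.
  case: fS => s fs _; have [_ fS _ _] := fs x xb.
  by rewrite cmpC vS //; case: (fS u fu).
- by exists (fun _ t => (t == v)%:R) => //; exact: vertexS.
Qed.

End Filling.

(** * The integer grid *)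

Section UnitCells.
Variable R : realType.
Implicit Types (p q k : nat) (y : R).

(* The cells of the cubulation of the line with the even integers as vertices: the
   point [p] if [p] is even, the segment from [p - 1] to [p + 1] if [p] is odd. *)
Definition in_cell1 p y := `|y - p%:R| <= (odd p)%:R.

Definition face1 p q := (p == q) || odd q && ((p == q.+1) || (p.+1 == q)).

Lemma face1_trans p q k : face1 p q -> face1 q k -> face1 p k.
Proof. by rewrite /face1; lia. Qed.

Lemma face1_sub p q y : face1 p q -> in_cell1 p y -> in_cell1 q y.
Proof.
rewrite /in_cell1 => /orP[/eqP-> //|/andP[oq pq]].
have -> : odd p = false by case/orP: pq => /eqP; lia.
rewrite oq normr_le0 subr_eq0 => /eqP ->.
case/orP: pq => /eqP => [->|<-]; rewrite -natr1; first by rewrite addrAC subrr add0r normr1.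
by rewrite opprD addrA subrr add0r normrN normr1.
Qed.

Lemma natr_dist_lt p q k : `|p%:R - q%:R| < k%:R :> R -> (p < q + k)%N /\ (q < p + k)%N.
Proof. by rewrite ltr_norml => /andP[pq qp]; split; rewrite -(ltr_nat R) natrD; lra. Qed.

Lemma interior_face1 p q y : in_cell1 p y -> `|y - p%:R| < 1 -> in_cell1 q y -> face1 p q.
Proof.
rewrite /in_cell1 => py ltpy qy.
have pq : `|p%:R - q%:R| <= (odd p)%:R + (odd q)%:R :> R.
  by rewrite -(subrK y p%:R) -addrA (le_trans (ler_normD _ _)) // lerD // distrC.
have pq1 : `|p%:R - q%:R| < (odd q).+1%:R :> R.
  by rewrite -(subrK y p%:R) -addrA (le_lt_trans (ler_normD _ _)) // -add1n natrD ltr_leD // distrC.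
have [pq2 qp2] := natr_dist_lt pq1.
have ltpq : `|p%:R - q%:R| < (odd p + odd q).+1%:R :> R.
  by rewrite -natr1 natrD (le_lt_trans pq) // ltrDl.
have [pq3 qp3] := natr_dist_lt ltpq.
by rewrite /face1; lia.
Qed.

Lemma facet1 q y : odd q -> `|y - q%:R| = 1 ->
  exists p, [/\ face1 p q, p != q, (p <= q.+1)%N & in_cell1 p y].
Proof.
move=> oq yq; have [le0|lt0] := leP 0 (y - q%:R).
  exists q.+1; rewrite /face1 /in_cell1 oq eqxx orbT leqnn /= oq normr_le0 -natr1; split=> //.
    by rewrite neq_ltn ltnSn orbT.
  by move: yq; rewrite ger0_norm // => yq; apply/eqP; lra.
exists q.-1; rewrite /face1 /in_cell1 oq prednK ?odd_gt0 // eqxx !orbT; split=> //.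
- by rewrite neq_ltn prednK ?odd_gt0 ?leqnn.
- by rewrite leqW ?leq_pred.
have -> : odd q.-1 = false by lia.
have : q.-1%:R + 1 = q%:R :> R by rewrite natr1 prednK ?odd_gt0.
by move: yq; rewrite ltr0_norm // normr_le0 => yq qE; apply/eqP; lra.
Qed.

Lemma in_cell1_range p k y : (p <= k.*2)%N -> in_cell1 p y -> 0 <= y <= k.*2%:R.
Proof.
rewrite /in_cell1 ler_norml => pk /andP[py yp].
have lo : (odd p)%:R <= p%:R :> R by rewrite ler_nat; case: p {pk py yp} => //= p; case: odd.
have hi : p%:R + (odd p)%:R <= k.*2%:R :> R by rewrite -natrD ler_nat; lia.
by apply/andP; split; lra.
Qed.

Lemma cell1_cover k y : 0 <= y <= k.*2%:R ->
  exists p, [/\ (p <= k.*2)%N, in_cell1 p y & `|y - p%:R| < 1].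
Proof.
move=> /andP[y0 yk]; have /andP[jy yj] := truncn_itv y0.
set j := Num.truncn y in jy yj; rewrite -natr1 in yj.
have jk : (j <= k.*2)%N by rewrite -(ler_nat R) (le_trans jy).
have [yE|ne] := eqVneq y j%:R.
  by exists j; split; rewrite // /in_cell1 yE subrr normr0 ?ler0n ?ltr01.
have ltjy : j%:R < y by rewrite lt_neqAle eq_sym ne.
have [oj|ej] := boolP (odd j).
  by exists j; split; rewrite // /in_cell1 ?oj ger0_norm ?subr_ge0 //= ; lra.
exists j.+1; split; first by rewrite -(ltr_nat R) (lt_le_trans ltjy).
  by rewrite /in_cell1 -natr1 /= ej ler_norml /=; apply/andP; split; lra.
by rewrite -natr1 ltr_norml; apply/andP; split; lra.
Qed.

End UnitCells.

Section Grid.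
Variables (R : realType) (N k : nat).

Definition grid_index := {ffun 'I_N -> 'I_(k.*2).+1}.
Implicit Types (m n : grid_index) (x : 'rV[R]_N) (D : {set 'I_N}).

Definition free m : {set 'I_N} := [set i | odd (m i)].
Definition midpoint m : 'rV[R]_N := \row_i (m i)%:R.
Definition cell m := cube (free m) (midpoint m) 1.
Definition facets m := cube_boundary (free m) (midpoint m) 1.
Definition face n m := [forall i, face1 (n i) (m i)].

Lemma cellP m x : cell m x <-> forall i, in_cell1 (m i) (x 0 i).
Proof.
rewrite /in_cell1; split=> [[/= /rV_norm_leP-/(_ ler01) mx xE] i|mx].
  have := mx i; rewrite !mxE; case: (boolP (odd (m i))) => // ei _.
  by rewrite xE ?inE // mxE subrr normr0.
split=> [|i] /=; last first.
  by rewrite inE => /negbTE ei; have := mx i; rewrite ei normr_le0 subr_eq0 mxE => /eqP.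
by apply/rV_norm_leP => // i; rewrite !mxE (le_trans (mx i)) // lern1 leq_b1.
Qed.

Lemma not_facets m x : cell m x -> ~ facets m x -> forall i, `|x 0 i - (m i)%:R| < 1.
Proof.
move=> [/= mx xE] nf i; have : `|x - midpoint m| < 1.
  by rewrite lt_neqAle mx andbT; apply/eqP => xm; apply: nf.
by move/rV_norm_ltP => /(_ ltr01 i); rewrite !mxE.
Qed.

Lemma face_refl m : face m m.
Proof. by apply/forallP => i; rewrite /face1 eqxx. Qed.

Lemma face_trans m n p : face n m -> face m p -> face n p.
Proof.
by move=> /forallP nm /forallP mp; apply/forallP => i; exact: face1_trans (nm i) (mp i).
Qed.

Lemma face_sub n m : face n m -> cell n `<=` cell m.
Proof.
by move=> /forallP nm x /cellP nx; apply/cellP => i; exact: face1_sub (nm i) (nx i).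
Qed.

Lemma interior_face n m x : cell n x -> ~ facets n x -> cell m x -> face n m.
Proof.
move=> nx nf /cellP mx; apply/forallP => i.
by apply: interior_face1 (mx i); [move/cellP: nx|exact: not_facets nf i].
Qed.

Lemma facetsP m x : facets m x -> exists n, [/\ face n m, n != m & cell n x].
Proof.
move=> xm; have mx := cube_boundary_sub xm; case: xm => /= xm _.
have [|i xi] := @rV_norm_attained _ _ (x - midpoint m).
  by rewrite -normr_gt0 xm ltr01.
rewrite xm !mxE in xi; have oi : odd (m i).
  by move/cellP: mx => /(_ i); rewrite /in_cell1 -xi; case: odd => //; rewrite ler10.
have [p [pm np pk px]] := facet1 oi (esym xi).
have ltp : (p < (k.*2).+1)%N by have := ltn_ord (m i); lia.
exists [ffun j => if j == i then Ordinal ltp else m j]; split.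
- by apply/forallP => j; rewrite ffunE; case: eqP => [->//|_]; rewrite /face1 eqxx.
- by apply: contra np => /eqP/ffunP/(_ i); rewrite ffunE eqxx => <-.
by apply/cellP => j; rewrite ffunE; case: eqP => [->//|_]; move/cellP: mx.
Qed.

Lemma proper_face_card n m : face n m -> n != m -> (#|free n| < #|free m|)%N.
Proof.
move=> /forallP nm nem; apply: proper_card; apply/properP; split.
  by apply/fintype.subsetP => i; rewrite !inE; have := nm i; rewrite /face1; lia.
have [i ni] : exists i, n i != m i.
  by apply/existsP; apply: contraR nem => /existsPn nE; apply/eqP/ffunP => i; apply/eqP/negPn.
rewrite -(inj_eq val_inj) /= in ni; have := nm i; rewrite /face1.
by exists i; rewrite inE; lia.
Qed.

Lemma midpoint_cell m : cell m (midpoint m).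
Proof. by apply/cellP => i; rewrite /in_cell1 mxE subrr normr0. Qed.

Lemma cell_diameter m x y : cell m x -> cell m y -> `|x - y| <= 2.
Proof.
move=> [/= mx _] [/= my _]; rewrite -(subrK (midpoint m) x) -addrA.
by rewrite (le_trans (ler_normD _ _)) // [leRHS](_ : _ = 1 + 1) // lerD // distrC.
Qed.

Definition grid D : {set grid_index} :=
  [set m : grid_index | [forall i, (i \notin D) ==> (m i == 0 :> nat)]].
Definition grid_boundary D : {set grid_index} :=
  [set m : grid_index in grid D | [exists i in D, (m i == 0 :> nat) || (m i == k.*2 :> nat)]].
Definition grid_center D : 'rV[R]_N := \row_i (if i \in D then k%:R else 0).

Lemma gridP D m : reflect (forall i, i \notin D -> m i = 0 :> nat) (m \in grid D).
Proof.
rewrite inE; apply: (iffP forallP) => m0 i; first by move=> iD; have := m0 i; rewrite iD => /eqP.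
by apply/implyP => /m0 ->.
Qed.

Lemma grid_face D n m : face n m -> m \in grid D -> n \in grid D.
Proof.
move=> /forallP nm /gridP m0; apply/gridP => i iD; have := nm i.
by rewrite /face1 m0 // orbF => /eqP.
Qed.

Lemma grid_boundaryP D m :
  reflect (m \in grid D /\ exists2 i, i \in D & (m i == 0 :> nat) || (m i == k.*2 :> nat))
    (m \in grid_boundary D).
Proof.
rewrite [m \in grid_boundary D]finset.in_set.
by apply: (iffP andP) => -[mD mi]; split=> //; exact/exists_inP.
Qed.

Lemma grid_boundary_face D n m : face n m -> m \in grid_boundary D -> n \in grid_boundary D.
Proof.
move=> nm /grid_boundaryP[mD [i iD mi]]; apply/grid_boundaryP; split; first exact: grid_face mD.
by exists i => //; move/forallP: nm => /(_ i); rewrite /face1; lia.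
Qed.

Lemma grid_cell_sub D m : m \in grid D -> cell m `<=` cube D (grid_center D) k%:R.
Proof.
move=> /gridP m0 x /cellP mx; split=> [|i iD] /=; last first.
  have := mx i; rewrite /in_cell1 m0 // normr_le0 subr0 => /eqP ->.
  by rewrite mxE (negbTE iD).
apply/rV_norm_leP => // i; rewrite !mxE; case: (boolP (i \in D)) => [_|/m0 mi].
  have /andP[xi0 xik] := in_cell1_range (ltn_ord (m i) : (m i <= k.*2)%N) (mx i).
  by rewrite -addnn natrD in xik; rewrite ler_norml; apply/andP; split; lra.
have := mx i; rewrite /in_cell1 mi normr_le0 subr0 => /eqP ->.
by rewrite normr0.
Qed.

Lemma grid_boundary_cell_sub D m : m \in grid_boundary D ->
  cell m `<=` cube_boundary D (grid_center D) k%:R.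
Proof.
move=> /grid_boundaryP[mD [i iD mi]] x mx.
have [/= xk xc] := grid_cell_sub mD mx; split=> //=.
apply/eqP; rewrite eq_le xk; move/cellP: mx => /(_ i); rewrite /in_cell1.
have -> : odd (m i) = false by case/orP: mi => /eqP ->; rewrite ?odd_double.
rewrite normr_le0 subr_eq0 => /eqP xi; move/rV_norm_leP: (lexx `|x - grid_center D|).
move=> /(_ (normr_ge0 _) i); apply: le_trans; rewrite !mxE iD xi.
by case/orP: mi => /eqP ->; rewrite ?sub0r ?normrN -?addnn ?natrD ?addrK ger0_norm.
Qed.

Lemma grid_cover D x : cube D (grid_center D) k%:R x ->
  exists m, [/\ m \in grid D, cell m x & forall i, `|x 0 i - (m i)%:R| < 1].
Proof.
move=> [/= /rV_norm_leP-/(_ (ler0n _ _)) xk xc].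
have /choice[m m_cell] i : exists p : 'I_(k.*2).+1,
    [/\ i \notin D -> p = 0 :> nat, in_cell1 p (x 0 i) & `|x 0 i - p%:R| < 1].
  have [iD|iD] := boolP (i \in D); last first.
    by exists ord0; rewrite /in_cell1 xc // mxE (negbTE iD) subrr normr0; split.
  have [|p [pk xp ltxp]] := @cell1_cover _ k (x 0 i); last first.
    by exists (Ordinal (pk : (p < (k.*2).+1)%N)); split.
  have := xk i; rewrite !mxE iD ler_norml -addnn natrD => /andP[xi_ge xi_le].
  by apply/andP; split; lra.
exists [ffun i => m i]; split.
- by apply/gridP => i iD; rewrite ffunE; case: (m_cell i) => ->.
- by apply/cellP => i; rewrite ffunE; case: (m_cell i).
- by move=> i; rewrite ffunE; case: (m_cell i).
Qed.

Lemma grid_boundary_cover D x : (0 < k)%N -> cube_boundary D (grid_center D) k%:R x ->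
  exists2 m, m \in grid_boundary D & cell m x.
Proof.
move=> k0 xb; have [m [mD mx ltx]] := grid_cover (cube_boundary_sub xb).
exists m => //; apply/grid_boundaryP; split=> //; case: xb => /= xk xc.
have [|i xi] := @rV_norm_attained _ _ (x - grid_center D).
  by rewrite -normr_gt0 xk ltr0n.
rewrite xk !mxE in xi; have iD : i \in D.
  apply: contraLR k0 => iD; move: xi; rewrite (negbTE iD) xc // mxE (negbTE iD) subrr normr0.
  by move/eqP; rewrite pnatr_eq0 => /eqP ->.
exists i => //; rewrite iD in xi.
have even_cell q : ~~ odd q -> x 0 i = q%:R -> m i = q :> nat.
  move=> /negbTE eq xq; have := @interior_face1 R (m i) q (x 0 i).
  have -> : in_cell1 q (x 0 i) by rewrite /in_cell1 xq subrr normr0.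
  by move/cellP: mx => /(_ i) -> /(_ isT (ltx i) isT); rewrite /face1 eq orbF => /eqP.
have : (x 0 i == 0) || (x 0 i == k.*2%:R).
  move/esym/eqP: xi; rewrite eqr_norml ler0n andbT -addnn natrD => /orP[]/eqP xi; apply/orP.
    by right; apply/eqP; lra.
  by left; apply/eqP; lra.
case/orP => /eqP xi0; first by rewrite (even_cell 0%N).
by rewrite (even_cell k.*2) ?odd_double ?eqxx ?orbT.
Qed.

End Grid.

(** * Attaching cones *)

Section CarrierExtension.
Variables (R : realType) (T : eqType) (cmp : rel T) (N k : nat).
Notation cell := (@cell R N k).
Notation facets := (@facets R N k).
Implicit Types (m n : grid_index N k) (G L : {set grid_index N k}) (f : 'rV[R]_N -> T -> R).

Lemma flag_map_facets (S : set T) m f :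
  (forall n, face n m -> n != m -> flag_map cmp S (cell n) f) ->
  flag_map cmp S (facets m) f.
Proof.
move=> fS; pose proper_faces := \big[setU/set0]_(n | face n m && (n != m)) cell n.
apply: (@flag_map_sub _ _ _ _ S S proper_faces) => //.
  by move=> x /facetsP[n [nm ne nx]]; rewrite /proper_faces (bigD1 n) ?nm //=; left.
apply: flag_map_bigsetU => [n _|n /andP[nm ne]]; [exact: cube_closed|exact: fS].
Qed.

Lemma carrier_extension G L (C : grid_index N k -> set T) f :
  (forall m n, face n m -> m \in G -> n \in G) ->
  (forall m n, face n m -> m \in L -> n \in L) ->
  (forall m, m \in G -> m \notin L -> fills R cmp #|free m| (C m)) ->
  (forall m n, m \in G -> m \notin L -> face n m -> n \in L -> flag_map cmp (C m) (cell n) f) ->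
  (forall m n, m \in G -> face n m -> C n `<=` C m) ->
  exists2 g, (forall m x, m \in L -> cell m x -> g x = f x) &
    forall m, m \in G -> m \notin L -> flag_map cmp (C m) (cell m) g.
Proof.
have [p] := ubnP #|G :\: L|; elim: p L f => // p IH L f GLp Gface Lface fillC fC CS.
have [GL0|[m0 m0GL]] := set_0Vmem (G :\: L).
  exists f => // m mG mL; have : m \in G :\: L by rewrite inE mL.
  by rewrite GL0 inE.
have [m /finset.setDP[mG mL] m_min] := arg_minnP (fun m => #|free m|) m0GL.
have faceL n : face n m -> n != m -> n \in L.
  move=> nm ne; apply: contraTT (proper_face_card nm ne) => nL.
  by rewrite -leqNgt; apply: m_min; apply/finset.setDP; split=> //; exact: Gface mG.
have [|h hC hf] := fillC m mG mL N (free m) (midpoint R m) 1 f erefl ltr01.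
  by apply: flag_map_facets => n nm ne; apply: fC => //; exact: faceL.
pose g x := if `[< cell m x /\ ~ facets m x >] then h x else f x.
have gm x : cell m x -> g x = h x.
  move=> mx; rewrite /g; case: asboolP => // nmx; rewrite hf //.
  by apply: contrapT => nf; apply: nmx.
have gL n x : n \in L -> cell n x -> g x = f x.
  move=> nL nx; rewrite /g; case: asboolP => // -[mx nf].
  by case/negP: mL; apply: Lface nL; exact: interior_face nx.
have [||||g' g'L g'C] := IH (m |: L) g _ Gface _ _ _ CS.
- move: GLp; rewrite ltnS; apply: leq_trans.
  by rewrite [X in (_ < X)%N](cardsD1 m) inE mG mL finset.setDDl finset.setUC.
- move=> q n nq; rewrite !in_setU1 => /orP[/eqP qm|/(Lface _ _ nq) ->]; last by rewrite orbT.
  by have [//|ne] := eqVneq n m; rewrite -qm in ne *; rewrite faceL -?qm.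
- by move=> q qG; rewrite in_setU1 negb_or => /andP[_]; exact: fillC.
- move=> q n qG; rewrite !in_setU1 negb_or => /andP[_ qL] nq /orP[/eqP nm|nL].
    apply: (@eq_flag_map _ _ _ _ _ _ h) => [x|]; rewrite nm; first by move/gm.
    by apply: flag_map_sub hC => //; apply: CS => //; rewrite -nm.
  by apply: (@eq_flag_map _ _ _ _ _ _ f) => [x /gL->//|]; exact: fC.
exists g' => [n x nL nx|n nG nL]; first by rewrite (g'L n) ?(gL n) // in_setU1 nL orbT.
have [->|ne] := eqVneq n m; last by apply: g'C; rewrite // in_setU1 negb_or ne.
by apply: (@eq_flag_map _ _ _ _ _ _ h) => // x mx; rewrite (g'L m) ?gm // setU11.
Qed.

End CarrierExtension.

Section Attaching.
Variables (R : realType) (T : eqType) (cmp : rel T).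
Hypotheses (cmpxx : reflexive cmp) (cmpC : symmetric cmp).
Variables S0 S : set T.
Hypothesis S0S : S0 `<=` S.
Hypothesis antichain : forall u v, S u -> S v -> ~ S0 u -> ~ S0 v -> cmp u v -> u = v.

(* A clique has at most one vertex outside [S0], so that the trimmed coordinates of a point
   do not all vanish. *)
Definition trim (a : T -> R) t : R := if `[< S0 t >] then a t else Num.max (a t - 2^-1) 0.

Lemma trim_ge0 a t : 0 <= a t -> 0 <= trim a t.
Proof. by rewrite /trim; case: asboolP => // _ _; rewrite le_max lexx orbT. Qed.

Lemma trim_neq0 a t : trim a t != 0 -> a t != 0 /\ (S0 t \/ 2^-1 < a t).
Proof.
rewrite /trim; case: asboolP => [S0t at0|_]; first by split; [|left].
case: (leP (a t - 2^-1) 0) => [_|]; first by rewrite eqxx.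
by rewrite subr_gt0 => lt2 _; split; [rewrite gt_eqF // (lt_trans _ lt2)|right].
Qed.

Lemma trim_support s a : flag_point cmp S s a -> exists2 t, t \in s & 0 < trim a t.
Proof.
move=> [a0 aS acmp asum].
have [[t at0 S0t]|noS0] := pselect (exists2 t, a t != 0 & S0 t).
  exists t; first by case: (aS t at0).
  by rewrite /trim asboolT // lt_neqAle eq_sym at0 a0.
have nS0 t : a t != 0 -> ~ S0 t by move=> at0 S0t; apply: noS0; exists t.
have [v av0] : exists v, a v != 0.
  apply: contrapT => none; have := @oner_neq0 R; rewrite -asum big1 ?eqxx // => t _.
  by apply: contrapT => /eqP at0; apply: none; exists t.
have [vs Sv] := aS v av0; exists v => //.
have av1 : a v = 1.
  rewrite -asum (bigD1_seq v) ?undup_uniq ?mem_undup //= big1 ?addr0 // => t /eqP tv.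
  apply: contrapT => /eqP at0; apply: tv.
  by apply: antichain; [case: (aS t at0)|exact: Sv|exact: nS0|exact: nS0|exact: acmp].
by rewrite /trim asboolF ?av1 ?lt_max; [apply/orP; left; lra|exact: nS0].
Qed.

Lemma trim_sum_gt0 s a : flag_point cmp S s a -> 0 < \sum_(t <- undup s) trim a t.
Proof.
move=> sa; have [t ts at0] := trim_support sa; have [a0 _ _ _] := sa.
rewrite (bigD1_seq t) ?undup_uniq ?mem_undup //= ltr_pwDl // sumr_ge0 // => u _.
exact: trim_ge0.
Qed.

Lemma trim_continuous (X : topologicalType) (A : set X) (f : X -> T -> R) t :
  {within A, continuous (f^~ t)} -> {within A, continuous (fun x => trim (f x) t)}.
Proof.
move=> cf; rewrite /trim; case: asboolP => _ // x.
apply: (@continuous_max R (subspace A) (fun x => f x t - 2^-1) (fun=> 0)); last exact: cvg_cst.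
by apply: cvgB; [exact: cf|exact: cvg_cst].
Qed.

Lemma push_off (X : topologicalType) (A : set X) (f : X -> T -> R) : flag_map cmp S A f ->
  exists2 f' : X -> T -> R, flag_map cmp S A f' & forall x, A x -> forall t, f' x t != 0 ->
    f x t != 0 /\ (S0 t \/ 2^-1 < f x t).
Proof.
move=> [s fs cf]; pose W x := \sum_(t <- undup s) trim (f x) t.
have W_gt0 x : A x -> 0 < W x by move=> /fs/trim_sum_gt0.
have supp x t : trim (f x) t / W x != 0 -> f x t != 0 /\ (S0 t \/ 2^-1 < f x t).
  by rewrite mulf_eq0 negb_or => /andP[/trim_neq0].
exists (fun x t => trim (f x) t / W x) => [|x _ t]; last exact: supp.
exists s => [x Ax|t].
  have [f0 fS fcmp _] := fs x Ax; split.
  - by move=> t; rewrite divr_ge0 ?trim_ge0 // ltW ?W_gt0.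
  - by move=> t /supp[/fS].
  - by move=> t u /supp[ft _] /supp[fu _]; exact: fcmp.
  - by rewrite -mulr_suml divff // gt_eqF ?W_gt0.
rewrite continuous_subspace_in => x /set_mem Ax.
apply: cvgM; first exact: (trim_continuous (cf t)).
apply: cvgV; first by rewrite gt_eqF ?W_gt0.
by apply: cvg_big => [|u _]; [exact: add_continuous|exact: (trim_continuous (cf u))].
Qed.

Definition link v : set T := [set s | S0 s /\ cmp s v].

Section Pushed.
Variables (N k j : nat) (D : {set 'I_N}) (f f' : 'rV[R]_N -> T -> R).
Notation boundary := (cube_boundary D (grid_center R k D) k%:R).
Hypothesis fills_link : forall v i, S v -> ~ S0 v -> (i < j)%N -> fills R cmp i (link v).
Hypothesis fills_S0 : forall i, (i <= j)%N -> fills R cmp i S0.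
Hypotheses (k_gt0 : (0 < k)%N) (D_le : (#|D| <= j)%N).
Hypotheses (fS : flag_map cmp S boundary f) (f'S : flag_map cmp S boundary f').
Hypothesis f'_pushed : forall x, boundary x -> forall t, f' x t != 0 ->
  f x t != 0 /\ (S0 t \/ 2^-1 < f x t).
Hypothesis f_mesh : forall x y, boundary x -> boundary y -> `|x - y| <= 4 ->
  forall t, `|f x t - f y t| < 2^-1.
Implicit Types m n : grid_index N k.

(* The carrier of a cell with a heavy vertex is a cone; a cell without one, but in a cell
   with the heavy vertex [v], goes to the link of [v]; the other cells go to [S0]. *)
Let heavy m v : Prop := exists2 x, cell m x & [/\ boundary x, ~ S0 v & f' x v != 0].

Let carrier m : set T := [set t | (S0 t \/ heavy m t) /\
  forall n, n \in grid k D -> face m n -> forall v, heavy n v -> cmp t v].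

Let f_clique x t u : boundary x -> f x t != 0 -> f x u != 0 -> cmp t u.
Proof. by case: fS => s fs _ /fs[_ _ fcmp _]; exact: fcmp. Qed.

Let heavy_vertex m v : heavy m v -> S v.
Proof.
by move=> [x _ [xb _ fv]]; case: f'S => s f's _; have [_ f'0 _ _] := f's x xb; case: (f'0 v fv).
Qed.

Let heavy_near m v y : heavy m v -> boundary y -> (forall x, cell m x -> `|x - y| <= 4) ->
  f y v != 0.
Proof.
move=> [x mx [xb nS0 f'v]] yb xy.
have [_ [//|lt2]] := f'_pushed xb f'v.
by have := f_mesh xb yb (xy x mx) v; rewrite ltr_norml => /andP[_ ltf]; rewrite gt_eqF //; lra.
Qed.

Let heavy_cmp m n n' v v' : cell m `<=` @cell R N k n -> cell m `<=` @cell R N k n' ->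
  heavy n v -> heavy n' v' -> cmp v v'.
Proof.
move=> mn mn' nv n'v'; have [x nx [xb _ f'v]] := nv; apply: (f_clique xb).
  by case: (f'_pushed xb f'v).
apply: heavy_near n'v' xb _ => y n'y; have mp := @midpoint_cell R N k m.
have -> : 4 = 2 + 2 :> R by ring.
rewrite -(subrK (midpoint R m) y) -addrA (le_trans (ler_normD _ _)) //.
by apply: lerD; [apply: cell_diameter n'y _; exact: mn'|apply: cell_diameter nx; exact: mn].
Qed.

Let carrier_fills m : m \in grid k D -> fills R cmp #|free m| (carrier m).
Proof.
move=> mD; have free_le n : n \in grid k D -> (#|free n| <= j)%N.
  move=> /gridP n0; apply: leq_trans D_le; apply: subset_leq_card.
  by apply/fintype.subsetP => i; rewrite inE; apply: contraTT => /n0 ->.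
have [[v mv]|light] := pselect (exists v, heavy m v).
  apply: (cone_fills cmpxx cmpC (v := v)) => [|t [_ tcmp]]; last exact: tcmp (face_refl m) v mv.
  split=> [|n nD mn u nu]; first by right.
  by apply: (heavy_cmp (m := m)) mv nu => //; exact: face_sub.
have light_S0 t : S0 t \/ heavy m t -> S0 t by case=> // mt; case: light; exists t.
have [[n [nD mn [v nv]]]|none] :=
  pselect (exists n, [/\ n \in grid k D, face m n & exists v, heavy n v]).
  have -> : carrier m = link v.
    apply/seteqP; split=> t [tS0 tcmp]; first by split; [exact: light_S0|exact: tcmp nv].
    split=> [|n' n'D mn' u n'u]; first by left.
    rewrite (_ : u = v) //; have [[x _ [_ nS0u _]] [y _ [_ nS0v _]]] := (n'u, nv).
    apply: antichain nS0u nS0v _; [exact: heavy_vertex n'u|exact: heavy_vertex nv|].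
    by apply: (heavy_cmp (m := m)) n'u nv; exact: face_sub.
  have [x _ [_ nS0 _]] := nv; apply: fills_link => //; first exact: heavy_vertex nv.
  apply: leq_trans (free_le n nD); apply: proper_face_card => //.
  by apply/eqP => mnE; apply: light; exists v; rewrite mnE.
have -> : carrier m = S0; last by apply: fills_S0; exact: free_le.
apply/seteqP; split=> t; first by move=> [/light_S0].
by move=> S0t; split=> [|n nD mn v nv]; [left|case: none; exists n; split=> //; exists v].
Qed.

Let carrier_boundary m n : m \in grid k D -> n \in grid_boundary k D -> face n m ->
  flag_map cmp (carrier m) (cell n) f'.
Proof.
move=> mD nD nm; have [s f's cf'] := f'S; have nb := @grid_boundary_cell_sub R _ _ _ _ nD.
exists s => [y ny|t]; last exact: continuous_subspaceW nb (cf' t).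
have yb := nb y ny; have [f'0 f's' f'cmp f'sum] := f's y yb.
split=> // t f't; have [ts St] := f's' t f't; split=> //; split.
  have [|nS0] := pselect (S0 t); [by left|right].
  by exists y; [exact: face_sub nm y ny|].
move=> n' n'D mn' v n'v; apply: (f_clique yb); first by case: (f'_pushed yb f't).
apply: heavy_near n'v yb _ => x n'x; apply: (le_trans (y := 2)); last by rewrite ler_nat.
apply: cell_diameter n'x _; apply: (face_sub mn'); exact: (face_sub nm ny).
Qed.

Lemma pushed_extendable : extendable cmp S D (grid_center R k D) k%:R f'.
Proof.
have carrier_face m n : face n m -> carrier n `<=` carrier m.
  move=> nm t [tS0 tcmp]; split=> [|n' n'D mn' v n'v].
    by case: tS0 => [|[x nx xb]]; [left|right; exists x => //; exact: face_sub nm x nx].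
  by apply: tcmp n'v => //; exact: face_trans mn'.
have [g gL gC] := @carrier_extension R T cmp N k (grid k D) (grid_boundary k D) carrier f'
  (fun m n => @grid_face _ _ _ n m) (fun m n => @grid_boundary_face _ _ _ n m)
  (fun m mD _ => carrier_fills mD) (fun m n mD _ nm nD => carrier_boundary mD nD nm)
  (fun m n _ => @carrier_face m n).
exists g => [|x xb]; last first.
  by have [m mD mx] := grid_boundary_cover k_gt0 xb; exact: gL mD mx.
apply: (@flag_map_sub _ _ _ _ S S (\big[setU/set0]_(m in grid k D) cell m)) => //.
  by move=> x /grid_cover[m [mD mx _]]; rewrite (bigD1 m) //=; left.
apply: flag_map_bigsetU => m mD; first exact: cube_closed.
have [mL|mL] := boolP (m \in grid_boundary k D).
  apply: (@eq_flag_map _ _ _ _ _ _ f') => [x mx|]; first by rewrite (gL m).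
  by apply: flag_map_sub f'S => //; exact: grid_boundary_cell_sub.
apply: flag_map_sub (gC m mD mL) => // t [[/S0S//|mt] _]; exact: heavy_vertex mt.
Qed.

End Pushed.

Lemma attach_fills j :
  (forall v i, S v -> ~ S0 v -> (i < j)%N -> fills R cmp i (link v)) ->
  (forall i, (i <= j)%N -> fills R cmp i S0) ->
  forall i, (i <= j)%N -> fills R cmp i S.
Proof.
move=> fills_link fills_S0 i ij N D c r f Di r0 fS.
have [f' f'S f'_pushed] := push_off fS.
apply: (extendable_homotopic cmpC r0 fS f'S) => [x xb t u /(f'_pushed x xb)[ft _] fu|].
  by case: fS => s fs _; have [_ _ fcmp _] := fs x xb; exact: fcmp.
have [|d d0 f_mesh] := @flag_map_uniformly_continuous _ _ _ _ S _ f
  (@cube_boundary_compact _ _ D c r) fS 2^-1.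
  by rewrite invr_gt0.
pose k := (Num.truncn (4 * r / d)).+1; have k0 : 0 < k%:R :> R by rewrite ltr0n.
have kd : r / k%:R * 4 < d.
  by rewrite mulrAC ltr_pdivrMr // mulrC (mulrC d) -ltr_pdivrMr // truncnS_gt.
apply: (@extendable_rescale _ _ _ _ _ _ _ _ (grid_center R k D) k%:R) => //.
pose u := rescale (grid_center R k D) k%:R c r.
have ub x : cube_boundary D (grid_center R k D) k%:R x -> cube_boundary D c r (u x).
  by apply: rescale_boundary => //; exact: ltW.
have flag_u g : flag_map cmp S (cube_boundary D c r) g ->
    flag_map cmp S (cube_boundary D (grid_center R k D) k%:R) (g \o u).
  apply: flag_map_comp ub _; apply: rescale_continuous => [x _|]; first by rewrite gt_eqF.
  by apply: continuous_subspaceT; exact: cst_continuous.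
apply: (@pushed_extendable N k j D (f \o u)) => //; [by rewrite Di|exact: flag_u|exact: flag_u| |].
  by move=> x /ub; exact: f'_pushed.
move=> x y /ub xb /ub yb xy t; apply: f_mesh => //; apply: le_lt_trans kd.
rewrite /u /rescale opprD addrACA subrr add0r -scalerBr opprB addrA subrK normrZ ger0_norm.
  by rewrite ler_wpM2l // divr_ge0 // ltW.
by rewrite divr_ge0 // ltW.
Qed.

End Attaching.

(** * Constructible connectivity *)

Section Constructible.
Variables (T : eqType) (cmp : rel T).
Implicit Types S : set T.

(* [constructible n S] implies that the flag complex of [S] is [(n - 2)]-connected; when
   [S] is spherical, [n] is the number of elements of a maximal chain. *)
Inductive constructible : nat -> set T -> Prop :=
| constructible0 S : constructible 0 S
| constructible_cone n S v : S v -> (forall s, S s -> cmp s v) -> constructible n S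
| constructible_attach n S0 S : S0 `<=` S ->
    (forall u v, S u -> S v -> ~ S0 u -> ~ S0 v -> cmp u v -> u = v) ->
    constructible n S0 ->
    (forall v, S v -> ~ S0 v -> constructible n.-1 (link cmp S0 v)) ->
    constructible n S.

Lemma constructible_fills (R : realType) n S : reflexive cmp -> symmetric cmp ->
  constructible n S -> forall j, (j < n)%N -> fills R cmp j S.
Proof.
move=> cmpxx cmpC; elim=> {n S} [//|n S v Sv vS j _|n S0 S S0S anti _ fills0 _ fills_link j].
  exact: cone_fills vS.
case: n fills0 fills_link => // n fills0 fills_link; rewrite ltnS => jn.
apply: (attach_fills cmpxx cmpC S0S anti (j := n)) => // v i Sv nS0 lt_in.
exact: fills_link.
Qed.

Lemma constructible_le n n' S : (n' <= n)%N -> constructible n S -> constructible n' S.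
Proof.
move=> le_n'n cS; elim: cS n' le_n'n => {n S} [S|n S v Sv vS|n S0 S S0S anti _ c0 _ cl] n' n'n.
- by move: n'n; rewrite leqn0 => /eqP ->; exact: constructible0.
- exact: constructible_cone Sv vS.
- apply: (constructible_attach S0S anti) => [|v Sv nS0]; first exact: c0.
  by apply: cl => //; lia.
Qed.

Lemma constructible_nonempty n S : (0 < n)%N -> constructible n S -> exists v, S v.
Proof.
move=> + cS; elim: cS => {n S} [//|n S v Sv _ _|n S0 S S0S _ _ IH _ _ n0]; first by exists v.
by have [v /S0S] := IH n0; exists v.
Qed.

Section Ranked.
Variables (rk : T -> nat) (B : nat).
Hypotheses (rk_lt : forall x, (rk x < B)%N) (cmpC : symmetric cmp).
Hypothesis rk_inj : forall x y, cmp x y -> rk x = rk y -> x = y.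

Lemma constructible_attach_ranked n S0 S : S0 `<=` S -> constructible n S0 ->
  (forall v, S v -> ~ S0 v ->
     constructible n.-1 [set s | [/\ S s, S0 s \/ (rk s < rk v)%N & cmp s v]]) ->
  constructible n S.
Proof.
move=> S0S c0 clink; pose filtered b := [set s | S s /\ (S0 s \/ (rk s < b)%N)].
suff cfiltered b : constructible n (filtered b).
  have -> : S = filtered B by apply/seteqP; split=> [s Ss|s []//]; split=> //; right.
  exact: cfiltered.
elim: b => [|b IH].
  have -> : filtered 0%N = S0; last exact: c0.
  by apply/seteqP; split=> [s [_ []]//|s S0s]; split; [exact: S0S|left].
have new v : filtered b.+1 v -> ~ filtered b v -> [/\ S v, ~ S0 v & rk v = b].
  move=> [Sv rv] nv; have nS0 : ~ S0 v by move=> S0v; apply: nv; split=> //; left.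
  split=> //; case: rv => // rv; apply/eqP; rewrite eqn_leq -ltnS rv leqNgt.
  by apply/negP => lt_vb; apply: nv; split=> //; right.
apply: (constructible_attach (S0 := filtered b)) => // [s [Ss rs]|u v Su Sv nu nv|v Sv nv].
- by split=> //; case: rs => [|rs]; [left|right; exact: leqW].
- have [_ _ ru] := new u Su nu; have [_ _ rv] := new v Sv nv.
  by move=> uv; apply: rk_inj; rewrite // ru rv.
have [Sv' nS0 rv] := new v Sv nv; have := clink v Sv' nS0; rewrite rv.
by congr constructible; apply/seteqP; split=> s; [case|case=> -[]].
Qed.

Lemma constructible_joinr n (A A' : set T) : (forall x y, A x -> A' y -> cmp x y) ->
  constructible n A' -> constructible n (A `|` A').
Proof.
move=> AA' cA'; suff gen b : forall A : set T, (forall x y, A x -> A' y -> cmp x y) ->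
    (forall x, A x -> (rk x < b)%N) -> constructible n (A `|` A').
  by apply: (gen B) => // x _; exact: rk_lt.
elim: b => [|b IH] {AA'} {}A AA' rA.
  have -> : A `|` A' = A'; last by [].
  by apply/seteqP; split=> x; [case=> // /rA|right].
apply: (constructible_attach_ranked (S0 := A')) => // v [Av|//] nv.
apply: (constructible_le (leq_pred n)).
have -> : [set s | [/\ (A `|` A') s, A' s \/ (rk s < rk v)%N & cmp s v]] =
    [set s | [/\ A s, (rk s < rk v)%N & cmp s v]] `|` A'.
  apply/seteqP; split=> s /=.
    by case=> -[As|A's] [A's'|rs] sv; [right|left|right|right].
  move=> [[As rs sv]|A's]; first by split; [left|right|].
  by split; [right|left|rewrite cmpC; exact: AA'].
by apply: IH => [x y [Ax _ _]|x [_ rx _]]; [exact: AA'|rewrite (leq_trans rx) // -ltnS rA].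
Qed.

Lemma constructible_join m n (A A' : set T) : (forall x y, A x -> A' y -> cmp x y) ->
  constructible m A -> constructible n A' -> constructible (m + n) (A `|` A').
Proof.
move=> AA' cA cA'; elim: cA AA' => {m A} [A|m A v Av vA|m A0 A A0A anti _ IH0 _ IHlink] AA'.
- exact: constructible_joinr.
- apply: constructible_cone (or_introl Av) _ => s [/vA//|A's].
  by rewrite cmpC; exact: AA'.
have A0A' x y : A0 x -> A' y -> cmp x y by move=> /A0A; exact: AA'.
apply: (constructible_attach (S0 := A0 `|` A')); first exact: setSU.
- move=> u v [Au|A'u] [Av|A'v] nu nv; try by [case: nu; right|case: nv; right].
  by apply: anti => // A0x; [apply: nu|apply: nv]; left.
- exact: IH0.
move=> v [Av|A'v] nv; last by case: nv; right.
have nA0 : ~ A0 v by move=> A0v; apply: nv; left.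
have -> : link cmp (A0 `|` A') v = link cmp A0 v `|` A'.
  apply/seteqP; split=> s /=; first by case=> -[As|A's] sv; [left|right].
  by case=> [[A0s sv]|A's]; split; [left| |right|rewrite cmpC; exact: AA'].
apply: constructible_le (IHlink v Av nA0 _); first lia.
by move=> x y [A0x _]; exact: A0A'.
Qed.

End Ranked.

End Constructible.

Section Poset.
Variable T : eqType.
Implicit Types (le : rel T) (S : set T).

Definition comparability le : rel T := fun x y => le x y || le y x.

Definition ranked_poset le (rk : T -> nat) (B : nat) : Prop :=
  [/\ reflexive le, transitive le, antisymmetric le,
      forall x y, plt le x y -> (rk x < rk y)%N & forall x, (rk x < B)%N].

Definition dual le : rel T := fun x y => le y x.

Lemma comparability_refl le : reflexive le -> reflexive (comparability le).
Proof. by move=> lexx x; rewrite /comparability lexx. Qed.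

Lemma comparability_sym le : symmetric (comparability le).
Proof. by move=> x y; rewrite /comparability orbC. Qed.

Lemma comparability_dual le : comparability (dual le) = comparability le.
Proof. by apply/funext => x; apply/funext => y; rewrite /comparability orbC. Qed.

Lemma plt_dual le x y : plt (dual le) x y = plt le y x.
Proof. by rewrite /plt eq_sym. Qed.

Lemma plt_trans le : transitive le -> antisymmetric le -> transitive (plt le).
Proof.
move=> le_trans le_anti y x z /andP[xy nxy] /andP[yz nyz]; rewrite /plt (le_trans y) //=.
by apply: contra nxy => /eqP xz; apply/eqP/le_anti; rewrite xy xz.
Qed.

Lemma ranked_dual le rk B : ranked_poset le rk B ->
  ranked_poset (dual le) (fun x => B - rk x)%N B.+1.
Proof.
move=> [lexx letr lea rk_lt rk_B]; split=> //.
- by move=> y x z yx zy; exact: letr zy yx.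
- by move=> x y /andP[yx xy]; apply/lea/andP.
- by move=> x y; rewrite plt_dual => /rk_lt; have := rk_B x; lia.
- by move=> x; rewrite ltnS leq_subr.
Qed.

Lemma ranked_inj le rk B x y : ranked_poset le rk B ->
  comparability le x y -> rk x = rk y -> x = y.
Proof.
move=> [_ _ _ rk_lt _] xy rxy; apply/eqP; apply: contraT => ne.
case/orP: xy => xy; have := rk_lt _ _ (introT andP (conj xy _)); rewrite rxy ltnn; apply=> //.
by rewrite eq_sym.
Qed.

Lemma constructible_min le n S v : S v -> (forall x, S x -> le v x) ->
  constructible (comparability le) n S.
Proof.
by move=> Sv vS; apply: constructible_cone Sv _ => x /vS vx; rewrite /comparability vx orbT.
Qed.

Lemma constructible_max le n S v : S v -> (forall x, S x -> le x v) ->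
  constructible (comparability le) n S.
Proof.
by move=> Sv Sle; apply: constructible_cone Sv _ => x /Sle xv; rewrite /comparability xv.
Qed.

(* The new elements are added by increasing rank. *)
Lemma constructible_attach_up le rk B n S0 S : ranked_poset le rk B -> S0 `<=` S ->
  constructible (comparability le) n S0 ->
  (forall v, S v -> ~ S0 v -> exists a b, [/\ (n.-1 <= a + b)%N,
     constructible (comparability le) a [set x | S x /\ plt le x v] &
     constructible (comparability le) b [set x | S0 x /\ plt le v x]]) ->
  constructible (comparability le) n S.
Proof.
move=> rP S0S c0 clink; have rk_inj x y := @ranked_inj _ _ _ x y rP.
have [lexx letr lea rk_lt rk_B] := rP.
apply: (constructible_attach_ranked rk_B rk_inj S0S c0) => v Sv nS0.
have [a [b [nab ca cb]]] := clink v Sv nS0; apply: (constructible_le nab).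
rewrite (_ : [set s | _] = [set x | S x /\ plt le x v] `|` [set x | S0 x /\ plt le v x]).
  apply: (constructible_join rk_B (@comparability_sym le) rk_inj) ca cb.
  by move=> x y [_ /andP[xv _]] [_ /andP[vy _]]; rewrite /comparability (letr v).
apply/seteqP; split=> x /=; last first.
  move=> [[Sx xv]|[S0x vx]]; split=> //; [by right; exact: rk_lt| |exact: S0S|by left|].
    by rewrite /comparability; case/andP: xv => ->.
  by rewrite /comparability; case/andP: vx => ->; rewrite orbT.
move=> [Sx xS0 xv]; have ne : x != v.
  by apply/eqP => e; case: xS0; rewrite e // ltnn.
case/orP: xv => xv; first by left; rewrite /plt xv.
right; have vx : plt le v x by rewrite /plt xv eq_sym.
by split=> //; case: xS0 => //; have := rk_lt _ _ vx; lia.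
Qed.

Lemma constructible_attach_down le rk B n S0 S : ranked_poset le rk B -> S0 `<=` S ->
  constructible (comparability le) n S0 ->
  (forall v, S v -> ~ S0 v -> exists a b, [/\ (n.-1 <= a + b)%N,
     constructible (comparability le) a [set x | S0 x /\ plt le x v] &
     constructible (comparability le) b [set x | S x /\ plt le v x]]) ->
  constructible (comparability le) n S.
Proof.
move=> /ranked_dual rP S0S c0 clink; rewrite -comparability_dual.
apply: (constructible_attach_up rP S0S); rewrite comparability_dual // => v Sv nS0.
have [a [b [nab ca cb]]] := clink v Sv nS0; exists b, a; rewrite addnC; split=> //.
  by under eq_set do rewrite plt_dual.
by under eq_set do rewrite plt_dual.
Qed.

(* The elements above a new [x] contract to [phi x], by induction on their corank. *)
Lemma constructible_retract_up le rk B n S0 S (phi : T -> T) : ranked_poset le rk B ->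
  S0 `<=` S -> (forall x, S x -> S0 (phi x) /\ le x (phi x)) ->
  (forall x y, S x -> S y -> le x y -> le (phi x) (phi y)) ->
  constructible (comparability le) n S0 -> constructible (comparability le) n S.
Proof.
move=> rP; have [lexx letr lea rk_lt rk_B] := rP.
suff gen b : forall S0 S, (forall x, S x -> B - rk x < b)%N ->
    S0 `<=` S -> (forall x, S x -> S0 (phi x) /\ le x (phi x)) ->
    (forall x y, S x -> S y -> le x y -> le (phi x) (phi y)) ->
    constructible (comparability le) n S0 -> constructible (comparability le) n S.
  by apply: (gen B.+1) => x _; rewrite ltnS leq_subr.
elim: b => [|b IH] {}S0 {}S rS S0S phiS phi_mono c0.
  by rewrite (_ : S = S0) //; apply/seteqP; split=> // x /rS.
apply: (constructible_attach_down rP S0S c0) => x Sx nS0.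
exists 0%N, n; split; [by rewrite add0n leq_pred|exact: constructible0|].
have [S0px xpx] := phiS x Sx.
apply: (IH [set y | [/\ S y, plt le x y & le (phi x) y]]).
- move=> y [Sy /rk_lt xy]; have := rS x Sx; have := rk_B x; have := rk_B y; lia.
- by move=> y [].
- move=> y [Sy /[dup] xy /andP[lexy _]]; have [S0py ypy] := phiS y Sy; split=> //; split.
  + exact: S0S.
  + have [->|ney] := eqVneq (phi y) y; first by [].
    by apply: (plt_trans letr lea) xy _; rewrite /plt ypy eq_sym.
  + exact: phi_mono.
- by move=> y z [Sy _] [Sz _]; exact: phi_mono.
apply: (constructible_min n (v := phi x)) => [|y []//]; split=> //; first exact: S0S.
by rewrite /plt xpx /=; apply/eqP => e; apply: nS0; rewrite e.
Qed.

Lemma constructible_retract_down le rk B n S0 S (phi : T -> T) : ranked_poset le rk B ->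
  S0 `<=` S -> (forall x, S x -> S0 (phi x) /\ le (phi x) x) ->
  (forall x y, S x -> S y -> le x y -> le (phi x) (phi y)) ->
  constructible (comparability le) n S0 -> constructible (comparability le) n S.
Proof.
move=> /ranked_dual rP S0S phiS phi_mono; rewrite -comparability_dual.
by apply: (constructible_retract_up rP S0S phiS) => x y Sx Sy; exact: phi_mono.
Qed.

End Poset.

(** * Connectivity of realizations *)

Lemma continuous_row (R : realType) N (X : topologicalType) (f : 'I_N -> X -> R) :
  (forall i, continuous (f i)) -> continuous (fun x => \row_i f i x).
Proof.
move=> cf x A [P Px PA]; have cP j : nbhs (f j x) (P 0 j) by have := Px 0 j; rewrite mxE.
have nearP := filter_forall (nbhs_filter x) (fun j => cf j x _ (cP j)).
apply: (@filterS _ (nbhs x) _ _ _ _ nearP) => y Py; apply: PA => i j.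
by rewrite mxE (ord1 i); exact: Py.
Qed.

Section EuclideanSphere.
Variables (R : realType) (N : nat).
Implicit Type x : 'rV[R]_N.

Lemma continuous_sum_coord (P : pred 'I_N) : continuous (fun x => \sum_(i | P i) x 0 i).
Proof. by apply: continuous_big => [|i _]; [exact: add_continuous|exact: coord_continuous]. Qed.

Definition euclidean (x : 'rV[R]_N) : R := Num.sqrt (\sum_i x 0 i ^+ 2).

Lemma sum_sqr_continuous : continuous (fun x => \sum_i x 0 i ^+ 2).
Proof.
apply: continuous_big => [|i _]; first exact: add_continuous.
move=> x; apply: (@continuous_comp _ _ _ (fun x => x 0 i) (fun y => y ^+ 2)).
  exact: coord_continuous.
exact: exprn_continuous.
Qed.

Lemma euclidean_continuous : continuous euclidean.
Proof.
move=> x; apply: (@continuous_comp _ _ _ (fun x => \sum_i x 0 i ^+ 2) Num.sqrt).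
  exact: sum_sqr_continuous.
exact: sqrt_continuous.
Qed.

Lemma norm_le_euclidean x : `|x| <= euclidean x.
Proof.
apply/rV_norm_leP => [|i]; first exact: sqrtr_ge0.
rewrite -sqrtr_sqr ler_sqrt; last by apply: sumr_ge0 => j _; exact: sqr_ge0.
by rewrite (bigD1 i) //= lerDl; apply: sumr_ge0 => j _; exact: sqr_ge0.
Qed.

Lemma euclideanZ a x : euclidean (a *: x) = `|a| * euclidean x.
Proof.
rewrite /euclidean; under eq_bigr do rewrite mxE exprMn.
by rewrite -mulr_sumr sqrtrM ?sqr_ge0 // sqrtr_sqr.
Qed.

Lemma euclidean_lt1 x : `|x| < N.+1%:R^-1 -> euclidean x < 1.
Proof.
move=> xN; rewrite -sqrtr1 ltr_sqrt //; set r : R := N.+1%:R^-1 in xN.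
have r01 : 0 <= r <= 1 by rewrite invr_ge0 ler0n invf_le1 ?ltr0n // ler1n.
have : \sum_(i < N) x 0 i ^+ 2 <= \sum_(i < N) r.
  apply: ler_sum => i _; have /rV_norm_leP/(_ i) := ltW xN; case/andP: r01 => r0 r1.
  move=> /(_ r0) xi; rewrite -real_normK ?num_real // expr2 -[leRHS]mulr1.
  by apply: ler_pM => //; exact: le_trans r1.
move/le_lt_trans; apply; rewrite sumr_const card_ord -mulr_natl.
by rewrite ltr_pdivrMr ?ltr0n // mul1r ltr_nat.
Qed.

Lemma unit_sphere_compact : compact [set x : 'rV[R]_N | \sum_i x 0 i ^+ 2 = 1].
Proof.
apply: bounded_closed_compact.
  exists 1; split=> [|M M1 x /= x1]; first exact: num_real.
  by apply: le_trans (norm_le_euclidean x) _; rewrite /euclidean x1 sqrtr1 ltW.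
apply: (@preimage_closed _ _ (fun x => \sum_i x 0 i ^+ 2) [set 1]) => [x _|].
  exact: sum_sqr_continuous.
exact: closed_eq.
Qed.

Lemma euclidean1P x : \sum_i x 0 i ^+ 2 = 1 <-> euclidean x = 1.
Proof.
rewrite /euclidean; split=> [->|/(congr1 (fun y => y ^+ 2))]; first by rewrite sqrtr1.
by rewrite sqr_sqrtr ?expr1n // sumr_ge0 // => i _; exact: sqr_ge0.
Qed.

(* The extension is constant on the rays outside a small cube. *)
Lemma extend_from_sphere (T : eqType) (cmp : rel T) (S : set T) (f : 'rV[R]_N -> T -> R) :
  fills R cmp N S ->
  flag_map cmp S [set x : 'rV[R]_N | \sum_i x 0 i ^+ 2 = 1] f ->
  exists2 g : 'rV[R]_N -> T -> R, flag_map cmp S [set: 'rV[R]_N] g &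
    forall x, \sum_i x 0 i ^+ 2 = 1 -> g x = f x.
Proof.
move=> fillS fS; pose r : R := N.+1%:R^-1; have r0 : 0 < r by rewrite invr_gt0 ltr0n.
pose normalize x : 'rV[R]_N := (euclidean x)^-1 *: x.
pose outer := [set x : 'rV[R]_N | r <= `|x|].
have norm_sub0 x : `|x - 0| = `|x| by rewrite subr0.
have euclidean_gt0 x : outer x -> 0 < euclidean x.
  by move=> /= rx; rewrite (lt_le_trans r0) // (le_trans rx) // norm_le_euclidean.
have f_outer : flag_map cmp S outer (f \o normalize).
  apply: flag_map_comp fS => [x /euclidean_gt0 x0|].
    by apply/euclidean1P; rewrite euclideanZ normfV gtr0_norm // mulVf // gt_eqF.
  rewrite continuous_subspace_in => x /set_mem xo; apply: cvgZ.
    apply: cvgV; first by rewrite gt_eqF ?euclidean_gt0.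
    by apply: continuous_subspaceT; exact: euclidean_continuous.
  by apply: continuous_subspaceT => y; exact: cvg_id.
have [||g gS gf] := fillS N [set: 'I_N]%SET 0 r (f \o normalize) _ r0.
- by rewrite cardsT card_ord.
- by apply: flag_map_sub f_outer => // x [/= xr _]; rewrite /outer /= -norm_sub0 xr.
pose G x := if r <= `|x| then f (normalize x) else g x.
exists G => [|x /euclidean1P x1]; last first.
  rewrite /G /normalize x1 invr1 scale1r ifT // leNgt.
  by apply/negP => /euclidean_lt1; rewrite x1 ltxx.
have -> : [set: 'rV[R]_N] = outer `|` cube [set: 'I_N]%SET 0 r.
  apply/seteqP; split=> // x _; have [rx|rx] := leP r `|x|; first by left.
  by right; split=> [/=|i]; rewrite ?norm_sub0 ?inE // ltW.
apply: flag_mapU; [|exact: cube_closed| |].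
- have -> : outer = [set x | r <= `|x - 0|] by under eq_set do rewrite norm_sub0.
  exact: (@closed_preimage_norm_sub _ _ 0 _ (@closed_ge _ r)).
- by apply: eq_flag_map f_outer => x /= rx; rewrite /G rx.
- apply: eq_flag_map gS => x [/= xr xc]; rewrite /G; case: ifP => // rx.
  by rewrite gf //; split=> //=; apply/eqP; rewrite eq_le xr norm_sub0.
Qed.

End EuclideanSphere.

Section Realization.
Variables (T : eqType) (le : rel T).
Hypotheses (le_refl : reflexive le) (le_trans : transitive le) (le_anti : antisymmetric le).
Implicit Types (S : set T) (s c : seq T) (a : T -> RR).
Notation cmp := (comparability le).

Lemma chain_uniq S c : is_chain le S c -> uniq c.
Proof.
by case=> sc _; apply: sorted_uniq sc; [exact: plt_trans|move=> x; rewrite /plt eqxx andbF].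
Qed.

Lemma chain_comparable S c : is_chain le S c -> {in c &, forall x y, cmp x y}.
Proof.
move=> [sc _] x y xc yc; have [->|xy] := eqVneq x y; first exact: comparability_refl.
wlog lt_xy : x y xc yc xy / (index x c < index y c)%N => [sym|].
  have [ij|ji|ij] := ltngtP (index x c) (index y c); first exact: sym.
    by rewrite comparability_sym; apply: sym; rewrite // eq_sym.
  by case/eqP: xy; rewrite -(nth_index x xc) ij nth_index.
have := sorted_ltn_index (plt_trans le_trans le_anti) sc x y xc yc lt_xy.
by rewrite /comparability => /andP[->].
Qed.

Lemma sort_is_chain S c : uniq c -> (forall t, t \in c -> S t) ->
  {in c &, forall x y, cmp x y} -> is_chain le S (sort le c).
Proof.
move=> uc cS cc; split=> [|t]; last by rewrite mem_sort; exact: cS.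
rewrite (sorted_pairwise (plt_trans le_trans le_anti)).
rewrite -[pairwise _ _]/(pairwise [rel x y | le x y && (x != y)] (sort le c)) pairwise_relI.
rewrite -uniq_pairwise sort_uniq uc andbT -(sorted_pairwise le_trans).
by apply: (@sort_sorted_in _ (mem c)) => [x y xc yc|]; [exact: cc|exact/allP].
Qed.

Lemma realizationP S a : realization le S a <-> exists s, flag_point cmp S s a.
Proof.
split=> [[c [cc a_out a0 asum]]|[s [a0 aS acmp asum]]].
  have in_c t : a t != 0 -> t \in c by apply: contraNT => /a_out ->.
  exists c; split=> // [t /[dup] /in_c tc _|t u /in_c tc /in_c uc|].
  - by split=> //; case: cc => _; exact.
  - exact: chain_comparable cc _ _ tc uc.
  - by rewrite undup_id //; exact: chain_uniq cc.
pose supp := [seq t <- undup s | a t != 0].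
have suppE t : (t \in supp) = (a t != 0).
  by rewrite mem_filter mem_undup andb_idr // => /aS[].
exists (sort le supp); split=> // [|t|].
- apply: sort_is_chain => [|t|t u]; rewrite ?filter_uniq ?undup_uniq ?suppE //.
    by move=> /aS[].
  exact: acmp.
- by rewrite mem_sort suppE negbK => /eqP.
- rewrite -asum -(undup_id (_ : uniq (sort le supp))) ?sort_uniq ?filter_uniq ?undup_uniq //.
  by apply: sum_undup_support => t at0; rewrite mem_sort suppE at0; case: (aS t at0).
Qed.

Lemma bary_continuous c t : continuous (fun l : 'rV[RR]_(size c) => bary l t).
Proof. exact: (@continuous_sum_coord (RR : realType)). Qed.

Lemma bary_out c (l : 'rV[RR]_(size c)) t : t \notin c -> bary l t = 0.
Proof. by move=> tc; rewrite /bary big1 // => i /eqP et; case/negP: tc; rewrite -et mem_nth. Qed.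

Lemma bary_row c a : uniq c -> (forall t, t \notin c -> a t = 0) ->
  bary (\row_(i < size c) a (tnth (in_tuple c) i)) = a.
Proof.
move=> uc a_out; apply/funext => t; have [/seq_tnthP[j tj]|tc] := boolP (t \in c); last first.
  by rewrite bary_out ?a_out.
rewrite /bary (big_pred1 j) ?mxE -?tj // => i.
by rewrite /= -(tnth_nth t (in_tuple c)) tj (inj_eq (elimT (tuple_uniqP (in_tuple c)) uc)).
Qed.

Lemma coh_open_coordinate S t (U : set RR) : open U -> coh_open le S [set a | U (a t)].
Proof.
move=> oU c _; exists [set l | U (bary l t)]; split=> //.
by apply: (@open_comp _ _ (fun l : 'rV[RR]_(size c) => bary l t) U) oU => l _;
  exact: bary_continuous.
Qed.

Lemma coh_open_small S s (e : T -> RR) : (forall t, 0 < e t) ->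
  coh_open le S [set a | forall t, t \notin s -> a t < e t].
Proof.
move=> e0 c _; pose large t := [set l : 'rV[RR]_(size c) | e t <= bary l t].
exists (~` \bigcup_(i in [set i | tnth (in_tuple c) i \notin s]) large (tnth (in_tuple c) i)).
split.
  apply/closed_openC/closed_bigcup => [|i _]; first exact: finite_finset.
  apply: (@preimage_closed _ _ _ [set y | e _ <= y]) => [l _|]; last exact: closed_ge.
  exact: bary_continuous.
congr (_ `&` _); apply/seteqP; split=> l /= small => [[i si]|t ts].
  by apply/negP; rewrite -ltNge; exact: small.
have [/seq_tnthP[i ti]|tc] := boolP (t \in c); last by rewrite bary_out.
by rewrite ltNge; apply/negP => et; apply: small; exists i; rewrite /= -?ti.
Qed.

Lemma cont_into_coordinate S m (K : set 'rV[RR]_m) f t : cont_into le S K f ->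
  {within K, continuous (f^~ t)}.
Proof.
move=> [_ cf]; apply/continuousP => U oU; apply/open_subspaceP.
have [V [oV KV]] := cf _ (@coh_open_coordinate S t _ oU).
by exists V => //; rewrite setIC -KV setIC.
Qed.

(* For every vertex [t] used by [f], fix one of the values [e t > 0] of its coordinate. The
   points whose coordinates outside [s] are smaller than [e] form an open set; by
   compactness [f] takes its values in one of them, and then uses the vertices in [s] only. *)
Lemma cont_into_flag_map S m (K : set 'rV[RR]_m) f : compact K -> cont_into le S K f ->
  flag_map cmp S K f.
Proof.
move=> cK /[dup] cf [fS fO].
have /choice[s fs] x : exists s, K x -> flag_point cmp S s (f x).
  by have [/fS/realizationP[s]|] := pselect (K x); [exists s|exists [::]].
have /choice[e e_attained] t : exists e : RR, 0 < e /\
    ((exists2 x, K x & f x t != 0) -> exists2 x, K x & f x t = e).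
  have [[x Kx fxt]|] := pselect (exists2 x, K x & f x t != 0); last by exists 1.
  exists (f x t); split; last by exists x.
  by rewrite lt_neqAle eq_sym fxt; have [-> //] := fs x Kx.
pose O x := [set a | forall t, t \notin s x -> a t < e t].
have [D DK KD] : finite_subset_cover K (fun x => K `&` f @^-1` O x) K.
  move: cK; rewrite compact_cover cover_compactE; apply.
    have /choice[V KV] x : exists V, open V /\ K `&` f @^-1` O x = K `&` V.
      by apply: fO; apply: coh_open_small => t; case: (e_attained t).
    by exists V => x _; case: (KV x).
  move=> x Kx; exists x => //; split=> // t; rewrite ltNge; apply: contra => ft.
  have [_ f_s _ _] := fs x Kx; case: (f_s t) => //.
  by rewrite gt_eqF // (lt_le_trans _ ft) //; case: (e_attained t).
exists (flatten [seq s x | x <- finmap.enum_fset D]) => [x Kx|t];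
  last exact: cont_into_coordinate cf.
have D_s t : f x t != 0 -> t \in flatten [seq s x | x <- finmap.enum_fset D].
  move=> ft; have [|y Ky fy] := (e_attained t).2; first by exists x.
  have [z zD [_ zy]] := KD y Ky; apply/flattenP; exists (s z); first exact: map_f.
  by apply: contraT => /zy; rewrite fy ltxx.
have [f0 f_s fcmp fsum] := fs x Kx; split=> // [t ft|].
  by split; [exact: D_s|case: (f_s t ft)].
by rewrite -fsum; apply: sum_undup_support => t ft; rewrite D_s //; case: (f_s t ft).
Qed.

Section FlagMapContInto.
Variables (S : set T) (m : nat) (K : set 'rV[RR]_m) (f : 'rV[RR]_m -> T -> RR) (s : seq T).
Hypothesis fs : forall x, K x -> flag_point cmp S s (f x).
Hypothesis cf : forall t, {within K, continuous (f^~ t)}.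

Let supported c : set 'rV[RR]_m := [set x | forall t, t \notin c -> f x t = 0].
Let coordinates c x : 'rV[RR]_(size c) := \row_i f x (tnth (in_tuple c) i).

Lemma coordinates_simplex c x : uniq c -> K x -> supported c x ->
  @std_simplex (size c) (coordinates c x).
Proof.
move=> uc Kx xc; have [f0 f_s _ fsum] := fs Kx; split=> [i|]; first by rewrite mxE.
rewrite -fsum; under eq_bigr do rewrite mxE.
rewrite -(big_tnth _ _ c xpredT) -{1}(undup_id uc); apply: sum_undup_support => t ft.
by case: (f_s t ft) => -> _; apply: contraNT ft => /xc ->.
Qed.

Lemma coordinates_trace c O (V : set 'rV[RR]_(size c)) x : uniq c ->
  @std_simplex (size c) `&` (@bary _ c @^-1` O) = @std_simplex (size c) `&` V ->
  K x -> supported c x -> O (f x) <-> V (coordinates c x).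
Proof.
move=> uc OV Kx xc; have simplex := coordinates_simplex uc Kx xc.
have baryE : bary (coordinates c x) = f x by exact: bary_row.
split=> [Ox|Vx].
  have : (@std_simplex (size c) `&` V) (coordinates c x) by rewrite -OV; split; rewrite //= baryE.
  by case.
have : (@std_simplex (size c) `&` (@bary _ c @^-1` O)) (coordinates c x) by rewrite OV.
by case=> _; rewrite /= baryE.
Qed.

Lemma supported_closed c : closed (supported c : set (subspace K)).
Proof.
have -> : supported c = \bigcap_(t in [set t | t \notin c]) (f^~ t @^-1` [set 0]) by [].
apply: closed_bigI => t _; apply: (@preimage_closed (subspace K) _ (f^~ t) [set 0]) => [x _|].
  exact: cf.
exact: closed_eq.
Qed.

Lemma coordinates_continuous c : {within K, continuous (coordinates c)}.
Proof.
by apply: (@continuous_row _ _ (subspace K) (fun i x => f x (tnth (in_tuple c) i))) => i; exact: cf.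
Qed.

Lemma supported_outside_closed c O : coh_open le S O -> is_chain le S c ->
  closed (supported c `&` f @^-1` (~` O) : set (subspace K)).
Proof.
move=> oO cc; have [V [oV OV]] := oO c cc; apply/closed_subspaceP.
have : closed (supported c `&` coordinates c @^-1` (~` V) : set (subspace K)).
  apply: closedI; first exact: supported_closed.
  apply: (@preimage_closed (subspace K)) => [x _|]; first exact: coordinates_continuous.
  exact: open_closedC.
move=> /closed_subspaceP[W cW WK]; exists W => //; rewrite WK.
apply/seteqP; split=> x [[xc nVO] Kx]; split=> //; split=> //.
  by move=> Ox; apply: nVO; apply/(coordinates_trace (chain_uniq cc) OV Kx xc).
by move=> Vx; apply: nVO; apply/(coordinates_trace (chain_uniq cc) OV Kx xc).
Qed.

(* [K] is covered by finitely many closed sets on which [f] is supported on a fixed chain. *)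
Lemma flag_map_cont_into : cont_into le S K f.
Proof.
split=> [x /fs sx|O oO]; first by apply/realizationP; exists s.
pose chain_of (b : (size (undup s)).-tuple bool) := sort le (mask b (undup s)).
pose bad := \bigcup_(b in [set b | is_chain le S (chain_of b)])
  (supported (chain_of b) `&` f @^-1` (~` O)).
have closed_bad : closed (bad : set (subspace K)).
  by apply: closed_bigcup => [|b cb]; [exact: finite_finset|exact: supported_outside_closed].
have /open_subspaceP[W oW WK] := closed_openC closed_bad.
exists W; split=> //; rewrite setIC [RHS]setIC WK; apply/seteqP; split=> x [].
  by move=> Ox Kx; split=> // -[b _ [_ /(_ Ox)]].
move=> nbad Kx; split=> //; have [a0 a_s acmp _] := fs Kx.
pose b : (size (undup s)).-tuple bool := map_tuple (fun t => f x t != 0) (in_tuple (undup s)).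
have bE : mask b (undup s) = [seq t <- undup s | f x t != 0] by rewrite filter_mask.
have suppE t : (t \in mask b (undup s)) = (f x t != 0).
  by rewrite bE mem_filter mem_undup andb_idr // => /a_s[].
have cb : is_chain le S (chain_of b).
  apply: sort_is_chain => [|t|t u]; rewrite ?suppE; [|by case/a_s|exact: acmp].
  by rewrite bE filter_uniq ?undup_uniq.
have xb : supported (chain_of b) x by move=> t; rewrite mem_sort suppE negbK => /eqP.
by apply: contrapT => nO; apply: nbad; exists b.
Qed.

End FlagMapContInto.

Lemma fills_extend_sphere S n : fills (RR : realType) cmp n.+1 S ->
  forall f, cont_into le S (@sphere n) f ->
  exists g, cont_into le S (@ball_closed n) g /\ (forall x, sphere x -> g x = f x).
Proof.
move=> fillS f cf; have fS := cont_into_flag_map (@unit_sphere_compact (RR : realType) n.+1) cf.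
have [g gS gf] := extend_from_sphere fillS fS; exists g; split=> //.
have [s gs cg] := flag_map_sub (fun t => id) (@subsetT _ (@ball_closed n)) gS.
exact: flag_map_cont_into gs cg.
Qed.

Lemma constructible_k_connected n S : constructible cmp n S -> k_connected le S (n%:Z - 2).
Proof.
have cmpxx := comparability_refl le_refl; have cmpC := @comparability_sym _ le.
move=> cS; split=> [n1|j jn f cf].
  have [|v Sv] := constructible_nonempty _ cS; first lia.
  by exists (fun t => (t == v)%:R); apply/realizationP; exists [:: v]; exact: flag_point_vertex.
by apply: fills_extend_sphere cf; apply: constructible_fills cS _ _ => //; lia.
Qed.

End Realization.

(** * Graded posets *)

Section Extended.
Variables (T : eqType) (le : rel T).
Hypotheses (le_trans : transitive le) (le_anti : antisymmetric le).
Implicit Types x y z : ext T.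

Lemma ext_le_refl : reflexive le -> forall x, ext_le le x x.
Proof. by move=> lexx [|a|] //=. Qed.

Lemma ext_le_trans y x z : ext_le le x y -> ext_le le y z -> ext_le le x z.
Proof. by case: x y z => [|a|] [|b|] [|c|] //=; exact: le_trans. Qed.

Lemma ext_le_anti x y : ext_le le x y -> ext_le le y x -> x = y.
Proof. by case: x y => [|a|] [|b|] //= ab ba; congr Mid; apply: le_anti; rewrite ab. Qed.

Lemma ext_lt_le_trans y x z : ext_lt le x y -> ext_le le y z -> ext_lt le x z.
Proof.
move=> [xy nxy] yz; split=> [|xz]; first exact: ext_le_trans yz.
by apply: nxy; apply: ext_le_anti; rewrite // xz.
Qed.

Lemma ext_le_lt_trans y x z : ext_le le x y -> ext_lt le y z -> ext_lt le x z.
Proof.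
move=> xy [yz nyz]; split=> [|xz]; first exact: ext_le_trans yz.
by apply: nyz; apply: ext_le_anti; rewrite // -xz.
Qed.

Lemma ext_lt_Mid a b : ext_lt le (Mid a) (Mid b) <-> plt le a b.
Proof.
split=> [[ab nab]|/andP[ab nab]].
  by apply/andP; split=> //; apply/eqP => e; apply: nab; rewrite e.
by split=> // -[e]; rewrite e eqxx in nab.
Qed.

Lemma open_interval_BotTop S : open_interval le S (Bot T) (Top T) = S.
Proof. by apply/seteqP; split=> [a []//|a Sa]; split=> //; split. Qed.

Lemma open_interval_BotMid S b : open_interval le S (Bot T) (Mid b) = [set a | S a /\ plt le a b].
Proof.
apply/seteqP; split=> a; first by move=> [Sa [_ /ext_lt_Mid ab]].
by move=> [Sa ab]; split=> //; split=> //; exact/ext_lt_Mid.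
Qed.

Lemma open_interval_MidTop S a : open_interval le S (Mid a) (Top T) = [set b | S b /\ plt le a b].
Proof.
apply/seteqP; split=> b; first by move=> [Sb [/ext_lt_Mid ab _]].
by move=> [Sb ab]; split=> //; split=> //; exact/ext_lt_Mid.
Qed.

Lemma open_interval_MidMid S a c :
  open_interval le S (Mid a) (Mid c) = [set b | S b /\ plt le a b /\ plt le b c].
Proof.
apply/seteqP; split=> b; first by move=> [Sb [/ext_lt_Mid ab /ext_lt_Mid bc]].
by move=> [Sb [ab bc]]; split=> //; split; exact/ext_lt_Mid.
Qed.

End Extended.

Section Saturated.
Variables (T : eqType) (le : rel T) (rk : T -> nat) (B : nat).
Hypothesis rP : ranked_poset le rk B.
Implicit Types (S : set T) (c : seq T) (x y : ext T) (lo hi : nat).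

Let le_refl : reflexive le. Proof. by case: rP. Qed.
Let le_trans : transitive le. Proof. by case: rP. Qed.
Let le_anti : antisymmetric le. Proof. by case: rP. Qed.
Let rk_lt a b : plt le a b -> (rk a < rk b)%N. Proof. by case: rP => _ _ _ h _; exact: h. Qed.

Definition rank_above lo hi x : nat :=
  match x with Bot => lo | Mid a => (rk a).+1 | Top => hi end.
Definition rank_below lo hi y : nat :=
  match y with Bot => lo | Mid b => rk b | Top => hi end.

Definition saturated S lo hi : Prop :=
  (forall a, S a -> (lo <= rk a < hi)%N) /\
  forall x y, in_ext S x -> in_ext S y -> ext_le le x y ->
    forall d, (rank_above lo hi x <= d < rank_below lo hi y)%N ->
    exists2 a, open_interval le S x y a & rk a = d.

Lemma chain_split S c d : is_chain le S c -> d \notin map rk c -> exists c1 c2,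
  [/\ c = c1 ++ c2, all (fun a => rk a < d)%N c1 & all (fun a => d < rk a)%N c2].
Proof.
move=> [sc _]; elim: c sc => [|a c IH] /= ac; first by exists [::], [::].
rewrite inE negb_or eq_sym neq_ltn => /andP[/orP[ad|da] dc].
  have [c1 [c2 [-> c1d c2d]]] := IH (path_sorted ac) dc.
  by exists (a :: c1), c2; rewrite /= ad.
exists [::], (a :: c); split; rewrite //= da; apply/allP => b bc.
by rewrite (ltn_trans da) // rk_lt //; move: b bc; apply/allP;
  exact: order_path_min (plt_trans _ _) ac.
Qed.

Lemma chain_ranks_uniq S c : is_chain le S c -> uniq (map rk c).
Proof.
move=> [sc _]; apply: (sorted_uniq ltn_trans ltnn).
by rewrite sorted_map; apply: sub_sorted sc => a b; exact: rk_lt.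
Qed.

Section SaturatedSet.
Variables (S : set T) (lo hi : nat).
Hypothesis satS : saturated S lo hi.

Lemma chain_ranks_sub c : is_chain le S c -> {subset map rk c <= iota lo (hi - lo)}.
Proof.
move=> [_ cS] d /mapP[a /cS Sa ->]; rewrite mem_iota.
by have /andP[la ah] := satS.1 a Sa; rewrite la subnKC // (leq_trans la) // ltnW.
Qed.

Lemma chain_size_le c : is_chain le S c -> (size c <= hi - lo)%N.
Proof.
move=> cc; rewrite -(size_map rk) -(size_iota lo (hi - lo)).
exact: uniq_leq_size (chain_ranks_uniq cc) (chain_ranks_sub cc).
Qed.

Lemma chain_insert c : is_chain le S c -> (size c < hi - lo)%N ->
  exists c', [/\ is_chain le S c', {subset c <= c'} & size c' = (size c).+1].
Proof.
move=> cc ltc; have [d dr dc] : exists2 d, d \in iota lo (hi - lo) & d \notin map rk c.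
  apply/hasP; apply: contraLR ltc => /hasPn dense.
  rewrite -leqNgt -(size_map rk) -{1}(size_iota lo (hi - lo)).
  by apply: uniq_leq_size (iota_uniq _ _) _ => d /dense /negPn.
have [c1 [c2 [cE c1d c2d]]] := chain_split cc dc; have [sc cS] := cc.
pose x := if c1 is a :: s then Mid (last a s) else Bot T.
pose y := if c2 is b :: _ then Mid b else Top T.
have c1_lt a : a \in c1 -> (rk a < d)%N by exact: (allP c1d).
have c2_gt a : a \in c2 -> (d < rk a)%N by exact: (allP c2d).
have c1S a : a \in c1 -> S a by move=> ac; apply: cS; rewrite cE mem_cat ac.
have c2S a : a \in c2 -> S a by move=> ac; apply: cS; rewrite cE mem_cat ac orbT.
have [||||z [Sz [xz zy]] zd] := satS.2 x y _ _ _ d.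
- by rewrite /x; case: (c1) c1S => [|a s] //= c1S; apply: c1S; exact: mem_last.
- by rewrite /y; case: (c2) c2S => [|b s] //= c2S; apply: c2S; exact: mem_head.
- rewrite /x /y; move: sc; rewrite cE; case: (c1) (c2) => [|a s] [|b s'] //=.
  by rewrite cat_path /= => /andP[_ /andP[/andP[ab _] _]].
- move: dr; rewrite mem_iota /x /y.
  case: (c1) c1_lt => [|a s] c1_lt; case: (c2) c2_gt => [|b s'] c2_gt /=; first lia.
  + by have := c2_gt b (mem_head _ _); lia.
  + by have := c1_lt _ (mem_last a s); lia.
  + by have := c1_lt _ (mem_last a s); have := c2_gt b (mem_head _ _); lia.
exists (c1 ++ z :: c2); split; last by rewrite cE !size_cat addnS.
  split; last by move=> t; rewrite mem_cat inE => /or3P[/c1S|/eqP->|/c2S].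
  have zc2 : path (plt le) z c2.
    move: sc zy; rewrite cE /y; case: (c2) => [|b s'] // sc /ext_lt_Mid zb.
    by rewrite /= zb; move: sc => /cat_sorted2[_].
  move: sc xz; rewrite cE /x; case: (c1) => [|a s] //= sc /ext_lt_Mid az.
  by rewrite cat_path /= az zc2; move: sc; rewrite cat_path => /andP[->].
by move=> t; rewrite cE !mem_cat inE => /orP[->|->]; rewrite ?orbT.
Qed.

Lemma saturated_maxchain_size c : is_maxchain le S c -> size c = (hi - lo)%N.
Proof.
move=> [cc cmax]; apply/eqP; rewrite eqn_leq chain_size_le //= leqNgt; apply/negP => ltc.
have [c' [cc' sub sz]] := chain_insert cc ltc.
have uc' := map_uniq (chain_ranks_uniq cc').
by have := uniq_leq_size uc' (cmax c' cc' sub); rewrite sz ltnn.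
Qed.

Lemma saturated_has_dim : has_dim le S ((hi - lo)%N%:Z - 1).
Proof.
split; last by move=> c /chain_size_le; rewrite subrK lez_nat.
suff chain_of_size n : (n <= hi - lo)%N -> exists2 c, is_chain le S c & size c = n.
  by have [c cc sz] := chain_of_size _ (leqnn _); exists c; rewrite subrK sz.
elim: n => [|n IH] le_n; first by exists [::].
have [c cc sz] := IH (ltnW le_n); have [|c' [cc' _ sz']] := chain_insert cc; first by rewrite sz.
by exists c'; rewrite // sz' sz.
Qed.

Lemma saturated_interval x y : in_ext S x -> in_ext S y -> ext_le le x y ->
  saturated (open_interval le S x y) (rank_above lo hi x) (rank_below lo hi y).
Proof.
move=> Sx Sy xy; split=> [a [Sa [xa ay]]|x' y' Ix' Iy' x'y' d dr].
  have /andP[la ah] := satS.1 a Sa; apply/andP; split.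
    by case: (x) xa => [|b|] //=; [move=> /ext_lt_Mid/rk_lt|case].
  by case: (y) ay => [|b|] //=; [case|move=> /ext_lt_Mid/rk_lt].
have between lower upper : in_ext S lower -> in_ext S upper -> ext_le le x lower ->
    ext_le le lower upper -> ext_le le upper y ->
    (rank_above lo hi lower <= d < rank_below lo hi upper)%N ->
    exists2 a, [/\ open_interval le S x y a, ext_lt le lower (Mid a) & ext_lt le (Mid a) upper] &
      rk a = d.
  move=> Sl Su xl lu uy /(satS.2 _ _ Sl Su lu)[a [Sa [la au]] rka]; exists a => //; split=> //.
  by split=> //; split; [exact: ext_le_lt_trans la|exact: ext_lt_le_trans uy].
case: x' y' Ix' Iy' x'y' dr => [|a|] [|b|] //= Ix' Iy' x'y' dr; try lia.
- have [Sb [[xb _] [yb _]]] := Iy'.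
  have [|c [Ic xc cb] rkc] := between x (Mid b) Sx Sb (ext_le_refl le_refl x) xb yb;
    first exact: dr.
  by exists c => //; split=> //; split.
- have [xx yy] := (ext_le_refl le_refl x, ext_le_refl le_refl y).
  have [|c [Ic xc cy] rkc] := between x y Sx Sy xx xy yy; first exact: dr.
  by exists c => //; split=> //; split.
- have [[Sa [[xa _] _]] [Sb [_ [yb _]]]] := (Ix', Iy').
  have [|c [Ic ac cb] rkc] := between (Mid a) (Mid b) Sa Sb xa x'y' yb; first exact: dr.
  by exists c.
- have [Sa [[xa _] [ay _]]] := Ix'.
  have [|c [Ic ac cy] rkc] := between (Mid a) y Sa Sy xa ay (ext_le_refl le_refl y);
    first exact: dr.
  by exists c => //; split=> //; split.
Qed.

End SaturatedSet.

Lemma saturated_cohen_macaulay S lo hi : saturated S lo hi ->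
  (forall x y, in_ext S x -> in_ext S y -> ext_le le x y ->
     constructible (comparability le) (rank_below lo hi y - rank_above lo hi x)
       (open_interval le S x y)) ->
  cohen_macaulay le S.
Proof.
move=> satS cS; split.
  exists ((hi - lo)%N%:Z - 1); split; first exact: saturated_has_dim.
  by move=> c /(saturated_maxchain_size satS) ->; rewrite subrK.
move=> x y Sx Sy xy; have sat_xy := saturated_interval satS Sx Sy xy.
eexists; split; first exact: saturated_has_dim sat_xy.
rewrite -addrA -opprD -[(1 + 1)%R]/(2 : int).
by apply: constructible_k_connected => //; exact: cS.
Qed.

End Saturated.

(** * Posets of subspaces *)

Section Hyperplanes.
Variables (F : fieldType) (E : vectType F).
Implicit Types (A H K V W X : {vspace E}) (y z : E).

Lemma subv_memv A V v : (A <= V)%VS -> v \in A -> v \in V.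
Proof. by move/subvP; apply. Qed.

Lemma memv_addr_line V v : v \in (V + <[v]>)%VS.
Proof. exact: subv_memv (addvSr _ _) (memv_line v). Qed.

Lemma ltn_dimv A V : (A <= V)%VS -> ~~ (V <= A)%VS -> (\dim A < \dim V)%N.
Proof. by move=> AV VA; rewrite (ltn_leqif (dimv_leqif_sup AV)). Qed.

Lemma dim_addv_line V v : v \notin V -> \dim (V + <[v]>) = (\dim V).+1.
Proof.
move=> vV; have v0 : v != 0 by apply: contraNneq vV => ->; exact: mem0v.
rewrite dimv_disjoint_sum ?dim_vline ?v0 ?addn1 //; apply/eqP; rewrite -subv0; apply/subvP => x.
rewrite memv_cap => /andP[xV /vlineP[c xE]]; move: xV; rewrite xE rpredZeq (negPf vV) orbF.
by move=> /eqP ->; rewrite scale0r mem0v.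
Qed.

Lemma leq_dim_addv_line V v : (\dim (V + <[v]>) <= (\dim V).+1)%N.
Proof.
have [vV|vV] := boolP (v \in V); last by rewrite dim_addv_line.
by rewrite (addv_idPl _) -?memvE.
Qed.

Definition hyperplane H V : bool := (H <= V)%VS && (\dim V == (\dim H).+1).

Lemma hyperplane_add H V K : hyperplane H V -> (K <= V)%VS -> ~~ (K <= H)%VS -> (H + K)%VS = V.
Proof.
move=> /andP[HV /eqP dV] KV KH; apply/eqP; rewrite eqEdim subv_add HV KV dV /=.
by apply: ltn_dimv; rewrite ?addvSl // subv_add subvv.
Qed.

Lemma dim_cap_hyperplane H V M : hyperplane H V -> (M <= V)%VS -> ~~ (M <= H)%VS ->
  \dim M = (\dim (M :&: H)).+1.
Proof.
move=> hypH MV MH; have := dimv_sum_cap H M; rewrite (hyperplane_add hypH MV MH) capvC.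
by case/andP: hypH => _ /eqP ->; lia.
Qed.

Lemma cap_hyperplane_add H V X K : hyperplane H V -> (X + K)%VS = V -> ~~ (X <= H)%VS ->
  ((X :&: H + K)%VS == V) = ~~ (X :&: K <= H)%VS.
Proof.
move=> hypH XK XH; have XV : (X <= V)%VS by rewrite -XK addvSl.
have KV : (K <= V)%VS by rewrite -XK addvSr.
rewrite eqEdim subv_add KV (subv_trans (capvSl _ _) XV) /=.
have := dimv_sum_cap X K; have := dimv_sum_cap (X :&: H)%VS K;
  have := dim_cap_hyperplane hypH XV XH.
rewrite XK -capvA (capvC H) capvA; have [XKH|XKH] := boolP (X :&: K <= H)%VS.
  by rewrite (capv_idPl XKH) => dX dXHK dXK; apply/negbTE; lia.
have := dim_cap_hyperplane hypH (subv_trans (capvSl X K) XV) XKH; lia.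
Qed.

Lemma exists_hyperplane_avoiding A V y : (A <= V)%VS -> y \in V -> y \notin A ->
  exists H, [/\ hyperplane H V, (A <= H)%VS & y \notin H].
Proof.
move=> AV yV yA; pose C := (V :\: (A + <[y]>))%VS.
have AyV : (A + <[y]> <= V)%VS by rewrite subv_add AV -memvE.
have yAC : y \notin (A + C)%VS.
  apply: contra yA => /memv_addP[a aA [c cC yE]].
  have : c \in (C :&: (A + <[y]>))%VS.
    rewrite memv_cap cC /= -[c](addKr a) -yE.
    by apply: memv_add; [rewrite memvN|exact: memv_line].
  by rewrite capv_diff memv0 yE => /eqP ->; rewrite addr0.
exists (A + C)%VS; split; [|exact: addvSl|exact: yAC].
rewrite /hyperplane -(dim_addv_line yAC) subv_add AV diffvSl /=.
by rewrite -addvA (addvC C) addvA (addvC _ C) addv_diff (addv_idPl AyV).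
Qed.

Lemma exists_hyperplane_avoiding_pair A V y z :
  (A <= V)%VS -> y \in V -> y \notin A -> z \notin A ->
  exists H, [/\ hyperplane H V, (A <= H)%VS, y \notin H & z \notin H].
Proof.
move=> AV yV yA zA; have [zV|zV] := boolP (z \in V); last first.
  have [H [hypH AH yH]] := exists_hyperplane_avoiding AV yV yA; exists H; split=> //.
  by apply: contra zV; apply: subv_memv; case/andP: hypH.
have [yAyz|yAyz] := boolP (y \in (A + <[y - z]>)%VS); last first.
  have [|H [hypH AyzH yH]] := exists_hyperplane_avoiding _ yV yAyz.
    by rewrite subv_add AV -memvE rpredB.
  move: AyzH; rewrite subv_add -memvE => /andP[AH yzH]; exists H; split=> //.
  by apply: contra yH => zH; rewrite -(subrK z y) rpredD.
have [H [hypH AH yH]] := exists_hyperplane_avoiding AV yV yA; exists H; split=> //.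
apply: contra yH => zH; move: yAyz => /memv_addP[a aA [_ /vlineP[c ->] yE]].
have [c1|c1] := eqVneq c 1.
  case/negP: zA; rewrite (_ : z = a) //; apply/eqP; rewrite -(inj_eq (addrI (y - z))).
  by rewrite subrK {1}yE c1 scale1r addrC.
have : (1 - c) *: y \in H.
  have -> : (1 - c) *: y = a - c *: z.
    by rewrite scalerBl scale1r {1}yE scalerBr addrA addrAC addrK.
  by rewrite rpredB ?rpredZ // (subv_memv AH).
by rewrite rpredZeq subr_eq0 eq_sym (negPf c1).
Qed.

Lemma subspace_between A V d : (A <= V)%VS -> (\dim A <= d <= \dim V)%N ->
  exists W, [/\ (A <= W)%VS, (W <= V)%VS & \dim W = d].
Proof.
have [n] := ubnP (d - \dim A)%N; elim: n A => // n IH A dn AV /andP[Ad dV].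
have [e|ne] := eqVneq (\dim A) d; first by exists A.
have /subvPn[y yV yA] : ~~ (V <= A)%VS by apply: contra ne => /dimvS; lia.
have [||| W [AyW WV dW]] := IH (A + <[y]>)%VS; rewrite ?dim_addv_line //; try lia.
  by rewrite subv_add AV -memvE.
by exists W; split=> //; exact: subv_trans (addvSl _ _) AyW.
Qed.

End Hyperplanes.

Section SubspacePosets.
Variables (F : fieldType) (E : vectType F).
Implicit Types (A H K L V W X : {vspace E}) (S : set {vspace E}).
Notation lt := (plt (@vsub_le F E)).
Notation vconstructible n S := (constructible (comparability (@vsub_le F E)) n S).

Lemma plt_vspace A V : lt A V = (A <= V)%VS && ~~ (V <= A)%VS.
Proof. by rewrite /plt /vsub_le eqEsubv; case: (A <= V)%VS. Qed.

Lemma plt_memv A V v : (A <= V)%VS -> v \in V -> v \notin A -> lt A V.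
Proof. by move=> AV vV vA; rewrite plt_vspace AV; apply: contra vA => /subv_memv; apply. Qed.

Lemma plt_dimv A V : (A <= V)%VS -> (\dim A < \dim V)%N -> lt A V.
Proof. by move=> AV dAV; rewrite plt_vspace AV; apply: contraL dAV => /dimvS; rewrite -leqNgt. Qed.

Lemma vspace_ranked : ranked_poset (@vsub_le F E) (fun W => \dim W) (\dim {:E}).+1.
Proof.
split; [exact: subvv|exact: subv_trans|exact: subv_anti| |].
  by move=> A V; rewrite plt_vspace => /andP[]; exact: ltn_dimv.
by move=> A; rewrite ltnS dimvS ?subvf.
Qed.

(* The condition [~~ (L <= W)] is void for [L = V]. *)
Definition supplements A V K L : set {vspace E} :=
  [set W | [/\ (A <= W)%VS, (W <= V)%VS, W != V, (W + K)%VS = V & ~~ (L <= W)%VS]].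

Lemma supplements_below A V K L W : supplements A V K L W ->
  [set X | supplements A V K L X /\ lt X W] = supplements A W (W :&: K) L.
Proof.
move=> [AW WV nWV WK LW]; apply/seteqP; split=> X /=.
  move=> [[AX XV nXV XK LX] /andP[XW nXW]]; split=> //.
  by rewrite capvC (vspace_modl _ XW) XK; apply/capv_idPr.
move=> [AX XW nXW XWK LX]; split; last by rewrite /plt /vsub_le XW.
split; [exact: AX|exact: subv_trans XW WV| | |exact: LX].
  by apply: contraNneq nXW => e; rewrite eqEsubv XW /= e.
by rewrite -{1}(addv_idPr (capvSr W K)) addvA XWK.
Qed.

Lemma supplements_above A V K L H W : hyperplane H V -> ~~ (K <= H)%VS -> ~~ (W <= H)%VS ->
  supplements A V K L W -> (W :&: H + K)%VS <> V ->
  [set X | (supplements A V K L X /\ (X :&: H + K)%VS = V) /\ lt W X] =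
  supplements W V (W + (K :&: H)) L.
Proof.
move=> hypH KH WH [AW WV nWV WK LW] nWHK.
have goodE X : (W <= X)%VS -> (X + K)%VS = V ->
    ((X :&: H + K)%VS == V) = ((X + (W + (K :&: H)))%VS == V).
  move=> WX XK; have XH : ~~ (X <= H)%VS by apply: contra WH; exact: subv_trans.
  rewrite addvA (addv_idPl WX) (cap_hyperplane_add hypH XK XH) capvC addvC.
  by rewrite (cap_hyperplane_add hypH _ KH) // addvC.
apply/seteqP; split=> X /=.
  move=> [[[AX XV nXV XK LX] /eqP good] /andP[WX nWX]].
  by split=> //; apply/eqP; rewrite -goodE.
move=> [WX XV nXV XWK LX]; have XK : (X + K)%VS = V.
  by apply/eqP; rewrite eqEsubv subv_add XV /= -{2}WK addvS // -WK addvSr.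
have good : (X :&: H + K)%VS = V by apply/eqP; rewrite goodE // XWK.
split; first by split=> //; split=> //; exact: subv_trans AW WX.
by rewrite /plt /vsub_le WX /=; apply/eqP => e; apply: nWHK; rewrite e.
Qed.

Lemma supplements_cap_hyperplane_constructible n A V K L H : hyperplane H V -> (K <= V)%VS ->
  (A <= H)%VS -> ~~ (K <= H)%VS -> ~~ (L <= H)%VS ->
  vconstructible n [set W | supplements A V K L W /\ (W :&: H + K)%VS = V].
Proof.
move=> hypH KV AH KH LH; have HV : (H <= V)%VS by case/andP: hypH.
have below_H W : (A <= W)%VS -> (W <= H)%VS -> (W + K)%VS = V -> supplements A V K L W.
  move=> AW WH WK; split; [exact: AW|exact: subv_trans WH HV| |exact: WK|].
    by apply: contraNneq KH => WV; rewrite WV in WH; exact: subv_trans KV WH.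
  by apply: contra LH => LW; exact: subv_trans LW WH.
apply: (constructible_retract_down (S0 := [set W | supplements A V K L W /\ (W <= H)%VS])
  (phi := capv^~ H) vspace_ranked).
- by move=> W [[AW WV nWV WK LW] WH]; rewrite /= (capv_idPl WH).
- move=> W [[AW _ _ _ _] WHK]; split; last exact: capvSl.
  by split; [apply: below_H => //; [rewrite subv_cap AW|exact: capvSr]|exact: capvSr].
- by move=> W W' _ _ WW'; exact: capvS.
apply: (constructible_max _ (v := H)) => [|W []//].
by split=> //; apply: below_H => //; exact: hyperplane_add.
Qed.

(* For a hyperplane [H >= A] containing neither [K] nor [L], the [W] with
   [(W :&: H) + K = V] contract to [H]; the other [W] are added by increasing dimension,
   along the join of two smaller instances. *)
Lemma supplements_constructible A V K L : (A <= K)%VS -> (K <= V)%VS -> ~~ (L <= A)%VS ->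
  vconstructible (\dim K - \dim A) (supplements A V K L).
Proof.
have [n] := ubnP (\dim V - \dim A)%N; elim: n A V K L => // n IH A V K L dn AK KV LA.
have AV := subv_trans AK KV; have [KA|KA] := boolP (K <= A)%VS.
  by have /eqP -> := dimvS KA; exact: constructible0.
have [KVE|nKV] := eqVneq K V.
  apply: (constructible_min _ (v := A)) => [|W []//]; split=> //.
    by apply: contraNneq KA => ->.
  by rewrite KVE; apply/addv_idPr; rewrite -KVE.
have /subvPn[y yK yA] := KA; have /subvPn[z zL zA] := LA.
have [H [hypH AH yH zH]] := exists_hyperplane_avoiding_pair AV (subv_memv KV yK) yA zA.
have KH : ~~ (K <= H)%VS by apply: contra yH => /subv_memv; apply.
have LH : ~~ (L <= H)%VS by apply: contra zH => /subv_memv; apply.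
apply: (constructible_attach_up vspace_ranked _
  (supplements_cap_hyperplane_constructible _ hypH KV AH KH LH)) => [W []//|W suppW ncapW].
have [AW WV nWV WK LW] := suppW.
have nWHK : (W :&: H + K)%VS <> V by move=> WHK; apply: ncapW.
have WH : ~~ (W <= H)%VS by apply/negP => WH; apply: nWHK; rewrite (capv_idPl WH).
have WKH : (W :&: K <= H)%VS.
  by have /eqP := nWHK; rewrite (cap_hyperplane_add hypH WK WH) negbK.
exists (\dim (W :&: K) - \dim A)%N, (\dim (W + (K :&: H)) - \dim W)%N; split.
- have := dim_cap_hyperplane hypH KV KH; have := dimv_sum_cap W (K :&: H)%VS.
  have : (\dim A <= \dim (W :&: K))%N by rewrite dimvS // subv_cap AW.
  by rewrite capvA (capv_idPl WKH); clear; lia.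
- rewrite (supplements_below suppW); apply: IH; rewrite ?subv_cap ?AW ?capvSl //.
  rewrite eqEsubv WV /= in nWV; have := ltn_dimv WV nWV; have := dimvS AW.
  by move: dn; clear; lia.
- rewrite (supplements_above hypH KH WH suppW nWHK); apply: IH; rewrite ?addvSl //.
    have WA : ~~ (W <= A)%VS.
      by apply: contra nKV => WA; rewrite -WK (addv_idPr (subv_trans WA AK)).
    by have := ltn_dimv AW WA; have := dimvS WV; move: dn; clear; lia.
  by rewrite subv_add WV (subv_trans (capvSl _ _)).
Qed.

Definition between A V : set {vspace E} := [set W | lt A W /\ lt W V].

Lemma between_constructible A V : (A <= V)%VS -> vconstructible (\dim V - \dim A).-1 (between A V).
Proof.
have [n] := ubnP (\dim V); elim: n V => // n IH V dn AV.
have [d1|d1] := leqP (\dim V - \dim A) 1.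
  by have -> : (\dim V - \dim A).-1 = 0%N by [lia]; exact: constructible0.
have /subvPn[y yV yA] : ~~ (V <= A)%VS by apply/negP => /dimvS; lia.
pose S0 := [set W | between A V W /\ (W + <[y]>)%VS != V].
have S0y W : (A <= W)%VS -> (W <= V)%VS -> (W + <[y]>)%VS != V -> S0 (W + <[y]>)%VS.
  move=> AW WV nV; rewrite /S0 /between /= !plt_vspace -addvA addvv nV.
  rewrite (subv_trans AW (addvSl _ _)) [(_ <= V)%VS]subv_add WV -memvE yV /=; split=> //; split.
    by apply: contra yA => /subv_memv; apply; exact: memv_addr_line.
  by apply: contra nV => VW; rewrite eqEsubv subv_add WV -memvE yV.
have cS0 : vconstructible (\dim V - \dim A).-1 S0.
  apply: (constructible_retract_up (S0 := [set W | S0 W /\ y \in W])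
    (phi := fun W => (W + <[y]>)%VS) vspace_ranked); first by move=> W [].
  - move=> W [[/andP[AW _] /andP[WV _]] nV]; split; last exact: addvSl.
    by split; [exact: S0y|exact: memv_addr_line].
  - by move=> W W' _ _ WW'; exact: addvS.
  apply: (constructible_min _ (v := (A + <[y]>)%VS)) => [|W [[[/andP[AW _] _] _] yW]].
    split; last exact: memv_addr_line.
    apply: S0y => //; apply/eqP => Ay; have := leq_dim_addv_line A y; rewrite Ay.
    by move: d1; clear; lia.
  by rewrite /vsub_le subv_add [(A <= W)%VS]AW -memvE.
apply: (constructible_attach_up vspace_ranked _ cS0) => [W []//|W bW nS0]; have [AW WV] := bW.
have WyV : (W + <[y]>)%VS = V by apply: contrapT => /eqP nV; apply: nS0.
exists (\dim W - \dim A).-1, 0%N; split; last exact: constructible0.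
  by have := leq_dim_addv_line W y; rewrite WyV; clear; lia.
have [_ letr lea rk_lt _] := vspace_ranked.
have -> : [set X | between A V X /\ lt X W] = between A W.
  apply/seteqP; split=> X /=; first by move=> [[]].
  by move=> [AX XW]; split=> //; split=> //; exact: plt_trans letr lea _ _ _ XW WV.
by apply: IH; [move: (rk_lt _ _ WV) dn; clear; lia|case/andP: AW].
Qed.

Lemma exists_max_dim (P : {vspace E} -> Prop) V : P V ->
  exists2 M, P M & forall W, P W -> (\dim W <= \dim M)%N.
Proof.
move=> PV; pose Pdim n := `[< exists2 W, P W & \dim W = n >].
have exP : exists n, Pdim n by exists (\dim V); apply/asboolP; exists V.
have boundP n : Pdim n -> (n <= \dim {:E})%N by move=> /asboolP[W _ <-]; exact/dimvS/subvf.
case: (ex_maxnP exP boundP) => _ /asboolP[M PM <-] maxM; exists M => // W PW.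
by apply: maxM; apply/asboolP; exists W.
Qed.

End SubspacePosets.

(** * Formed spaces *)

Section Forms.
Variables (F : fieldType) (E : vectType F).
Variables (sigma : {rmorphism F -> F}) (eps : F) (Lambda : pred F) (q : E -> E -> F).
Hypothesis params : form_parameters sigma eps Lambda.
Hypothesis sesq : sesquilinear sigma q.
Implicit Types (A M U V W X Z : {vspace E}) (u v w x y z : E).
Notation om := (omega sigma eps q).
Notation Qz := (Qzero Lambda q).
Notation iso := (isotropic sigma eps Lambda q).

Let sigmaK : involutive sigma. Proof. by case: params. Qed.
Let LambdaB a b : a \in Lambda -> b \in Lambda -> a - b \in Lambda.
Proof. by case: params => _ _ LB _ _; exact: LB. Qed.
Let LambdaD a b : a \in Lambda -> b \in Lambda -> a + b \in Lambda.
Proof. by move=> La Lb; rewrite -[b]opprK -[- b]sub0r -(subrr b) !LambdaB. Qed.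

Lemma omegaC v w : om w v = eps * sigma (om v w).
Proof.
rewrite /omega rmorphD rmorphM sigmaK mulrDr mulrA.
by case: params => _ -> _ _ _; rewrite mul1r addrC.
Qed.

Lemma omega_eq0C v w : om v w = 0 -> om w v = 0.
Proof. by move=> vw; rewrite omegaC vw rmorph0 mulr0. Qed.

Lemma omegaDr u v w : om u (v + w) = om u v + om u w.
Proof. by rewrite /omega; case: sesq => qD1 qD2 _; rewrite qD1 qD2 rmorphD mulrDr addrACA. Qed.

Lemma omegaZr u a v : om u (a *: v) = om u v * a.
Proof.
case: sesq => _ _ qZ; rewrite /omega -{1}(scale1r u) -{2}(scale1r u) !qZ rmorph1 mul1r mulr1.
by rewrite rmorphM sigmaK mulrDl (mulrC a) mulrA.
Qed.

Lemma omegaDl u v w : om (u + v) w = om u w + om v w.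
Proof. by rewrite omegaC omegaDr rmorphD mulrDr -!omegaC. Qed.

Lemma omegaZl a u v : om (a *: u) v = sigma a * om u v.
Proof. by rewrite omegaC omegaZr rmorphM mulrA -omegaC mulrC. Qed.

Lemma omegaBr u v w : om u (v - w) = om u v - om u w.
Proof. by rewrite omegaDr -scaleN1r omegaZr mulrN1. Qed.

Lemma omegaBl u v w : om (u - v) w = om u w - om v w.
Proof. by rewrite omegaDl -scaleN1r omegaZl rmorphN1 mulN1r. Qed.

Lemma omega0r u : om u 0 = 0.
Proof. by rewrite -(scale0r 0) omegaZr mulr0. Qed.

Lemma omega_self v : Qz v -> om v v = 0.
Proof. by case: params => _ _ _ _ Lanti; exact: Lanti. Qed.

Lemma QzeroD u v : om u v = 0 -> Qz u -> Qz v -> Qz (u + v).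
Proof.
rewrite /Qzero => uv Qu Qv; case: sesq => qD1 qD2 _; rewrite qD1 !qD2.
have -> : q u u + q u v + (q v u + q v v) = (q u u + q v v) + (q v u - eps * sigma (q v u)).
  have -> : q u v = - (eps * sigma (q v u)) by apply/eqP; rewrite -addr_eq0; apply/eqP.
  ring.
by apply: LambdaD; [exact: LambdaD|case: params].
Qed.

Definition pairings U v : 'rV[F]_(\dim U) := \row_i om (vbasis U)`_i v.

Definition orth U : {vspace E} := lker (linfun (pairings U)).

Let linfun_pairings U v : linfun (pairings U) v = pairings U v.
Proof.
have pairings_linear : linear (pairings U).
  by move=> a x y; apply/rowP => i; rewrite !mxE omegaDr omegaZr mulrC.
pose mixin := GRing.isLinear.Build _ _ _ _ (pairings U) pairings_linear.
exact: (lfunE (HB.pack (pairings U) mixin : {linear E -> 'rV_(\dim U)})).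
Qed.

Lemma orthP U v : v \in orth U <-> forall u, u \in U -> om u v = 0.
Proof.
rewrite memv_ker linfun_pairings; split=> [/eqP v0 u uU|v0]; last first.
  by apply/eqP/rowP => i; rewrite !mxE v0 // vbasis_mem // mem_nth // size_tuple.
rewrite (coord_vbasis uU); elim/big_rec: _ => [|i x _ x0]; first exact/omega_eq0C/omega0r.
by rewrite omegaDl omegaZl x0; have /rowP/(_ i) := v0; rewrite !mxE => ->; rewrite mulr0 addr0.
Qed.

Lemma orth_omega U u v : v \in orth U -> u \in U -> om u v = 0.
Proof. by move/orthP; apply. Qed.

Lemma orth_omegaC U u v : v \in orth U -> u \in U -> om v u = 0.
Proof. by move=> vU uU; apply: omega_eq0C; exact: orth_omega vU uU. Qed.

Lemma orthS U V : (U <= V)%VS -> (orth V <= orth U)%VS.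
Proof. by move=> UV; apply/subvP => v /orthP vV; apply/orthP => u uU; apply/vV/(subv_memv UV). Qed.

Lemma sub_orthC U V : (U <= orth V)%VS = (V <= orth U)%VS.
Proof.
suff sub X Y : (X <= orth Y)%VS -> (Y <= orth X)%VS by apply/idP/idP; exact: sub.
by move=> XY; apply/subvP => v vY; apply/orthP => u /(subv_memv XY) uY; exact: orth_omegaC uY vY.
Qed.

Lemma sub_orth_line z W : (W <= orth <[z]>)%VS = (z \in orth W).
Proof. by rewrite sub_orthC memvE. Qed.

Lemma mem_orth_line z v : (v \in orth <[z]>) = (om z v == 0).
Proof.
apply/idP/eqP => [vz|zv]; first exact: orth_omega vz (memv_line z).
by apply/orthP => _ /vlineP[c ->]; rewrite omegaZl zv mulr0.
Qed.

Lemma orth0 : orth 0%VS = fullv.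
Proof.
apply/eqP; rewrite eqEsubv subvf sub_orthC; apply/subvP => u; rewrite memv0 => /eqP ->.
exact: mem0v.
Qed.

Lemma orth_add U V : orth (U + V) = (orth U :&: orth V)%VS.
Proof.
apply/eqP; rewrite eqEsubv subv_cap !orthS ?addvSl ?addvSr //=.
by rewrite sub_orthC subv_add -2!(sub_orthC (orth U :&: orth V)) capvSl capvSr.
Qed.

Lemma codim_orth M C : (\dim M <= \dim (M :&: orth C) + \dim C)%N.
Proof.
rewrite -{1}(limg_ker_dim (linfun (pairings C)) M).
by rewrite leq_add2l (leq_trans (dimvS (subvf _))) // dimvf /dim /= mul1n.
Qed.

(* Both sides compute the rank of [om] on [M] and [W]. *)
Lemma dim_cap_orth M W :
  (\dim M + \dim (W :&: orth M) = \dim W + \dim (M :&: orth W))%N.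
Proof.
suff leq_dim X Y : (\dim X + \dim (Y :&: orth X) <= \dim Y + \dim (X :&: orth Y))%N.
  by apply/eqP; rewrite eqn_leq !leq_dim.
have dY := dimv_cap_compl Y (orth X); have := codim_orth X (Y :\: orth X).
have -> : (X :&: orth (Y :\: orth X) = X :&: orth Y)%VS.
  rewrite -{2}(addv_diff_cap Y (orth X)) orth_add capvA; apply/esym/capv_idPl.
  by rewrite (subv_trans (capvSl _ _)) // sub_orthC capvSr.
by move: dY; clear; lia.
Qed.

Definition form_kernel : {vspace E} := orth fullv.

Lemma kernel_omega u v : v \in form_kernel -> om u v = 0.
Proof. by move=> vK; exact: orth_omega vK (memvf u). Qed.

Lemma kernelP v : v \in form_kernel <-> Kset sigma eps q v.
Proof. by split=> [vK u|vK]; [exact: kernel_omega|apply/orthP]. Qed.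

Lemma kernel_sub_orth U : (form_kernel <= orth U)%VS.
Proof. exact/orthS/subvf. Qed.

Lemma sub_orth_kernel A Z : (A <= form_kernel)%VS -> (Z <= orth A)%VS.
Proof. by move=> AK; rewrite sub_orthC (subv_trans AK) // kernel_sub_orth. Qed.

Lemma orth_orth U : orth (orth U) = (U + form_kernel)%VS.
Proof.
have sub_orth2 X : (X <= orth (orth X))%VS by rewrite sub_orthC.
have orth3 : orth (orth (orth U)) = orth U by apply/eqP; rewrite eqEsubv orthS sub_orth2.
have UKU : (U + form_kernel <= orth (orth U))%VS by rewrite subv_add kernel_sub_orth sub_orth2.
apply/eqP; rewrite eq_sym eqEdim UKU /=.
have := dim_cap_orth fullv U; have := dim_cap_orth fullv (orth (orth U)).
have := dimv_sum_cap U form_kernel; have := dimvS UKU; rewrite orth3 !capfv -/form_kernel.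
by rewrite (capv_idPr (kernel_sub_orth _)); clear; lia.
Qed.

Lemma addv_orth_full W Z : (Z :&: form_kernel = 0)%VS ->
  ((W + orth Z)%VS == fullv) = ((Z :&: orth W)%VS == 0%VS).
Proof.
move=> ZK; rewrite eqEdim subvf -dimv_eq0 /=.
have := dim_cap_orth fullv Z; have := dim_cap_orth W Z; have := dimv_sum_cap W (orth Z).
rewrite ZK dimv0 capfv; move: (dimvS (subvf (W + orth Z)%VS)); clear; lia.
Qed.

Lemma dim_opposite W Z : (Z :&: orth W = 0)%VS -> (\dim (W :&: orth Z) + \dim Z = \dim W)%N.
Proof. by move=> ZW; have := dim_cap_orth W Z; rewrite ZW dimv0; clear; lia. Qed.

Lemma orth_cap_orth_line V w : (orth (V :&: orth <[w]>) <= orth V + <[w]>)%VS.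
Proof.
apply/subvP => x xVw; have [Vw|/subvPn[v0 v0V v0w]] := boolP (V <= orth <[w]>)%VS.
  by move: xVw; rewrite (capv_idPl Vw); apply: subv_memv; exact: addvSl.
rewrite mem_orth_line in v0w; pose c := sigma (om x v0 / om w v0).
rewrite -(subrK (c *: w) x); apply: memv_add; last by rewrite memvZ // memv_line.
apply/orthP => v vV; apply: omega_eq0C; pose l := om w v / om w v0.
have : om x (v - l *: v0) = 0.
  apply: orth_omegaC xVw _; rewrite memv_cap rpredB ?memvZ //= mem_orth_line.
  by rewrite omegaBr omegaZr /l mulrC divfK // subrr.
rewrite omegaBr omegaZr => /eqP; rewrite subr_eq0 => /eqP xv.
by rewrite omegaBl omegaZl /c sigmaK xv /l; field.
Qed.

Lemma isotropicS W W' : (W <= W')%VS -> iso W' -> iso W.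
Proof.
move=> WW' [om0 Q0]; split=> [v w vW wW|v vW]; last exact/Q0/(subv_memv WW').
by apply: om0; exact: subv_memv WW' _.
Qed.

Lemma isotropic_sub_orth W : iso W -> (W <= orth W)%VS.
Proof. by move=> [om0 _]; apply/subvP => v vW; apply/orthP => u uW; exact: om0. Qed.

Lemma isotropic_addv W W' : iso W -> iso W' -> (W' <= orth W)%VS -> iso (W + W').
Proof.
move=> isoW isoW' W'W; have [_ QW] := isoW; have [_ QW'] := isoW'.
split=> [v u|_ /memv_addP[v vW [u uW' ->]]]; last first.
  by apply: QzeroD; [exact: orth_omega (subv_memv W'W uW') vW|exact: QW|exact: QW'].
suff : (W + W' <= orth (W + W'))%VS by move=> sub vW uW; exact: orth_omega (subv_memv sub uW) vW.
by rewrite orth_add subv_cap !subv_add !isotropic_sub_orth // W'W -sub_orthC W'W.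
Qed.

Lemma isotropic_extend W M : iso M -> (\dim W < \dim M)%N ->
  exists v, [/\ v \in orth W, Qz v & v \notin W].
Proof.
move=> isoM ltWM; have /subvPn[v] : ~~ (M :&: orth W <= W)%VS.
  apply: contraL ltWM => MWW; rewrite -leqNgt; have := dim_cap_orth M W.
  have : (\dim (M :&: orth W) <= \dim (W :&: orth M))%N.
    by rewrite dimvS // subv_cap MWW (subv_trans (capvSl _ _)) // isotropic_sub_orth.
  by clear; lia.
by rewrite memv_cap => /andP[vM vW] nvW; exists v; split=> //; case: isoM => _; apply.
Qed.

Section Stable.
Hypothesis Lambda_stable : forall a c, c \in Lambda -> sigma a * c * a \in Lambda.

Lemma QzeroZ a v : Qz v -> Qz (a *: v).
Proof. by rewrite /Qzero => Qv; case: sesq => _ _ ->; exact: Lambda_stable. Qed.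

Lemma isotropic_line v : Qz v -> iso <[v]>.
Proof.
move=> Qv; split=> [_ _ /vlineP[a ->] /vlineP[b ->]|_ /vlineP[a ->]]; last exact: QzeroZ.
by rewrite -/(omega sigma eps q _ _) omegaZl omegaZr omega_self // mul0r mulr0.
Qed.

Lemma isotropic_addv_line W v : iso W -> Qz v -> v \in orth W -> iso (W + <[v]>).
Proof. by move=> isoW Qv vW; apply: isotropic_addv => //; exact: isotropic_line. Qed.

(* [Q (v + c *: u) = 0] is a linear equation in [sigma c]. *)
Lemma isotropize u v : Qz u -> om u v != 0 -> exists c, Qz (v + c *: u).
Proof.
move=> Qu uv; pose d := - (q v v) / om u v; exists (sigma d).
rewrite /Qzero; case: sesq => qD1 qD2 qZ; rewrite qD1 !qD2.
have qZr a x y : q x (a *: y) = q x y * a by rewrite -{1}(scale1r x) qZ rmorph1 mul1r.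
have qZl a x y : q (a *: x) y = sigma a * q x y by rewrite -{1}(scale1r y) qZ mulr1.
rewrite qZ qZr qZl sigmaK; set X := q v u * sigma d.
have -> : q v v + X + (d * q u v + d * q u u * sigma d) =
    (q v v + d * om u v) + (X - eps * sigma X) + sigma (sigma d) * q u u * sigma d.
  by rewrite /X /omega rmorphM sigmaK; ring.
rewrite /d divfK // subrr add0r; apply: LambdaD; last exact: Lambda_stable.
by case: params.
Qed.

(** * Isotropic subspaces opposite to a given subspace *)

Notation lt := (plt (@vsub_le F E)).
Notation vconstructible n S := (constructible (comparability (@vsub_le F E)) n S).

Definition above_radical A : Prop := forall v, Rad sigma eps Lambda q v -> v \in A.

Lemma mem_add_kernel V W t k : iso V -> above_radical W -> (W <= V)%VS -> t \in V ->
  k \in form_kernel -> (t + k \in (W + form_kernel)%VS) = (t \in W).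
Proof.
move=> [_ QV] radW WV tV kK; apply/idP/idP => [/memv_addP[s sW [k' k'K tk]]|tW].
  rewrite -(subrK s t) rpredD // radW //; split; last first.
    by apply: QV; rewrite rpredB // (subv_memv WV).
  apply/kernelP; have -> : t - s = k' - k by rewrite -(addrK k t) tk addrAC [s + k']addrC addrK.
  exact: rpredB.
exact: memv_add.
Qed.

Lemma exists_orth_omega A x : x \notin (A + form_kernel)%VS ->
  exists2 v, v \in orth A & om x v != 0.
Proof.
move=> xAK; apply: contrapT => none; case/negP: xAK; rewrite -orth_orth.
apply/orthP => v vA; apply: omega_eq0C; apply: contrapT => /eqP xv.
by apply: none; exists v.
Qed.

Definition max_isotropic M : Prop := iso M /\ forall W, iso W -> (\dim W <= \dim M)%N.

Section MaximalIsotropic.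
Variable M : {vspace E}.
Hypothesis maxM : max_isotropic M.

Definition iso_above A : set {vspace E} := [set W | iso W /\ lt A W].

Lemma iso_above_orth_constructible n A v : iso A -> v \in orth A -> v \notin A -> Qz v ->
  vconstructible n [set W | iso_above A W /\ (W <= orth <[v]>)%VS].
Proof.
move=> isoA vA nvA Qv.
have Av W : (A <= W)%VS -> lt A (W + <[v]>)%VS.
  by move=> AW; apply: plt_memv nvA; [exact: subv_trans AW (addvSl _ _)|exact: memv_addr_line].
apply: (constructible_retract_up (S0 := [set W | iso_above A W /\ v \in W])
  (phi := fun W => (W + <[v]>)%VS) (@vspace_ranked _ E)).
- move=> W [[isoW AW] vW]; split=> //; rewrite sub_orth_line.
  exact: subv_memv (isotropic_sub_orth isoW) vW.
- move=> W [[isoW /andP[AW _]]]; rewrite sub_orth_line => vW; split; last exact: addvSl.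
  by split; [split; [exact: isotropic_addv_line|exact: Av]|exact: memv_addr_line].
- by move=> W W' _ _ WW'; exact: addvS.
apply: (constructible_min _ (v := (A + <[v]>)%VS)) => [|W [[_ /andP[AW _]] vW]].
  by split; [split; [exact: isotropic_addv_line|exact: Av]|exact: memv_addr_line].
by rewrite /vsub_le subv_add [(A <= W)%VS]AW -memvE.
Qed.

Lemma iso_above_cap_orth_constructible n A v : iso A -> v \in orth A -> v \notin A -> Qz v ->
  vconstructible n [set W | iso_above A W /\ ~~ (W :&: orth <[v]> <= A)%VS].
Proof.
move=> isoA vA nvA Qv; have Av : (A <= orth <[v]>)%VS by rewrite sub_orth_line.
apply: (constructible_retract_down (phi := capv^~ (orth <[v]>)) (@vspace_ranked _ E))
  (iso_above_orth_constructible n isoA vA nvA Qv).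
- move=> W [[isoW AW] Wv]; split=> //; rewrite (capv_idPl Wv).
  by move: AW; rewrite plt_vspace => /andP[].
- move=> W [[isoW /andP[AW _]] WvA]; split; last exact: capvSl.
  split; last exact: capvSr.
  by split; [exact: isotropicS (capvSl _ _) isoW|rewrite plt_vspace subv_cap [(A <= W)%VS]AW Av].
- by move=> W W' _ _ WW'; exact: capvS.
Qed.

Lemma iso_above_constructible A N : iso A -> (N + \dim A <= \dim M)%N ->
  vconstructible N (iso_above A).
Proof.
have [isoM leM] := maxM; elim: N A => [|N IH] A isoA dN; first exact: constructible0.
have [|v [vA Qv nvA]] := isotropic_extend isoM (W := A); first by move: dN; clear; lia.
apply: (constructible_attach_up (@vspace_ranked _ E) _
  (iso_above_cap_orth_constructible _ isoA vA nvA Qv)).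
  by move=> W [].
have [_ letr lea rk_lt _] := (@vspace_ranked _ E).
have codim_v W : (\dim W <= (\dim (W :&: orth <[v]>)).+1)%N.
  by apply: leq_trans (codim_orth W <[v]>) _; rewrite dim_vline; case: (v != 0);
    rewrite ?addn1 ?addn0.
move=> V [isoV AV] nV; exists 0%N, N; split; [by []|exact: constructible0|].
have VvA : (V :&: orth <[v]> <= A)%VS by apply: contrapT => /negP VvA; apply: nV.
have dV : \dim V = (\dim A).+1.
  by have := codim_v V; have := dimvS VvA; have := rk_lt _ _ AV; clear; lia.
suff -> : [set W | (iso_above A W /\ ~~ (W :&: orth <[v]> <= A)%VS) /\ lt V W] = iso_above V.
  by apply: IH; rewrite // dV addnS.
apply/seteqP; split=> W /=; first by move=> [[[isoW _] _] VW].
move=> [isoW VW]; split=> //; split; first by split=> //; exact: plt_trans letr lea _ _ _ AV VW.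
by apply/negP => /dimvS; have := codim_v W; have := rk_lt _ _ VW; rewrite dV; clear; lia.
Qed.

Definition opposite A Z : set {vspace E} :=
  [set W | [/\ iso W, (A <= W)%VS & (Z :&: orth W = 0)%VS]].

Lemma opposite_up A Z V W : opposite A Z V -> iso W -> (V <= W)%VS -> opposite A Z W.
Proof.
move=> [_ AV ZV] isoW VW; split; [exact: isoW|exact: subv_trans AV VW|].
by apply/eqP; rewrite -subv0 -ZV capvS // orthS.
Qed.

Lemma opposite_below A Z V : opposite A Z V ->
  [set W | opposite A Z W /\ lt W V] = supplements A V (V :&: orth Z) V.
Proof.
move=> [isoV AV ZV]; apply/seteqP; split=> W /=.
  move=> [[isoW AW ZW]]; rewrite plt_vspace => /andP[WV nVW]; split=> //.
    by apply: contra nVW => /eqP ->.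
  apply/eqP; rewrite eqEdim subv_add WV capvSl /=.
  have := dimv_sum_cap W (V :&: orth Z)%VS; rewrite capvA (capv_idPl WV).
  by have := dim_opposite ZW; have := dim_opposite ZV; clear; lia.
move=> [AW WV _ WVZ nVW]; split; last by rewrite plt_vspace WV.
split; [exact: isotropicS isoV|exact: AW|].
apply/eqP; rewrite -subv0 -ZV -WVZ orth_add subv_cap capvSl subv_cap capvSr sub_orthC.
by apply: subv_trans (capvSr _ _) _; exact/orthS/capvSl.
Qed.

Lemma opposite_above A Z V : opposite A Z V ->
  [set W | opposite A Z W /\ lt V W] = iso_above V.
Proof.
move=> oppV; apply/seteqP; split=> W /=; first by move=> [[isoW _ _] VW].
by move=> [isoW VW]; split=> //; apply: (opposite_up oppV isoW); case/andP: VW.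
Qed.

Lemma line_cap0 z V : z != 0 -> (<[z]> :&: V = 0)%VS <-> z \notin V.
Proof.
move=> z0; split=> [zV|zV]; first by apply: contra z0 => zV'; rewrite -memv0 -zV memv_cap memv_line.
apply/eqP; rewrite -subv0; apply/subvP => x; rewrite memv_cap => /andP[/vlineP[c ->]].
by rewrite rpredZeq (negPf zV) orbF => /eqP ->; rewrite scale0r mem0v.
Qed.

Lemma opposite_add_line A Z z w : (Z <= orth (A + <[w]>))%VS -> om z w != 0 ->
  [set W | opposite A (Z + <[z]>) W /\ w \in W] = opposite (A + <[w]>) Z.
Proof.
rewrite orth_add subv_cap => /andP[_ Zw] zw; apply/seteqP; split=> W /=.
  move=> [[isoW AW ZzW] wW]; split=> //; first by rewrite subv_add AW -memvE.
  by apply/eqP; rewrite -subv0 -ZzW capvS // addvSl.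
move=> [isoW]; rewrite subv_add -memvE => /andP[AW wW] ZW; split=> //; split=> //.
apply/eqP; rewrite -subv0 -ZW subv_cap capvSr andbT; apply/subvP => x; rewrite memv_cap.
move=> /andP[/memv_addP[z' z'Z [_ /vlineP[c ->] ->]] xW]; have := orth_omegaC xW wW.
rewrite omegaDl omegaZl (orth_omegaC (subv_memv Zw z'Z) (memv_line w)) add0r => /eqP.
by rewrite mulf_eq0 (negPf zw) orbF fmorph_eq0 => /eqP ->; rewrite scale0r addr0.
Qed.

Definition opposite_cap_orth A Z w : set {vspace E} :=
  [set W | opposite A Z W /\ opposite A Z (W :&: orth <[w]>)%VS].

Section ContractTowards.
Variables (A Z : {vspace E}) (w : E).
Hypothesis Qw : Qz w.

Lemma opposite_orth_constructible n : vconstructible n [set W | opposite A Z W /\ w \in W] ->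
  vconstructible n [set W | opposite A Z W /\ (W <= orth <[w]>)%VS].
Proof.
apply: (constructible_retract_up (phi := fun W => (W + <[w]>)%VS) (@vspace_ranked _ E)).
- move=> W [oppW wW]; split=> //; rewrite sub_orth_line.
  by case: oppW => isoW _ _; exact: subv_memv (isotropic_sub_orth isoW) wW.
- move=> W [oppW]; rewrite sub_orth_line => wW; split; last exact: addvSl.
  split; last exact: memv_addr_line.
  by apply: (opposite_up oppW _ (addvSl _ _)); apply: isotropic_addv_line => //; case: oppW.
- by move=> W W' _ _ WW'; exact: addvS.
Qed.

Lemma opposite_cap_orth_constructible n : vconstructible n [set W | opposite A Z W /\ w \in W] ->
  vconstructible n (opposite_cap_orth A Z w).
Proof.
move/opposite_orth_constructible.
apply: (constructible_retract_down (phi := capv^~ (orth <[w]>)) (@vspace_ranked _ E)).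
- by move=> W [oppW Ww]; split=> //; rewrite (capv_idPl Ww).
- by move=> W [_ oppWw]; split; [split; [exact: oppWw|exact: capvSr]|exact: capvSl].
- by move=> W W' _ _ WW'; exact: capvS.
Qed.

End ContractTowards.

Section OppositeStep.
Variables (A Z Z' : {vspace E}) (z w : E).
Hypotheses (radA : above_radical A) (ZA : (Z <= orth A)%VS).
Hypotheses (defZ : (Z' + <[z]>)%VS = Z) (ZZ' : (Z <= orth Z')%VS).
Hypotheses (wA : w \in orth A) (wZ' : w \in orth Z') (Qw : Qz w) (zw : om z w != 0).

(* The component of [w] orthogonal to [W], modulo [Z]: it exists and differs from [w] exactly
   when cutting [W] by [orth <[w]>] loses the opposition to [Z]. *)
Definition foot W y : Prop := [/\ w - y \in Z, y \in orth W & y != w].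

Lemma footS V W y : (V <= W)%VS -> foot W y -> foot V y.
Proof. by move=> VW [wyZ yW yw]; split=> //; exact: subv_memv (orthS VW) yW. Qed.

Lemma foot_unique W y y' : opposite A Z W -> foot W y -> foot W y' -> y = y'.
Proof.
move=> [_ _ ZW] [wyZ yW _] [wy'Z y'W _]; apply/eqP; rewrite -subr_eq0 -memv0 -ZW memv_cap.
have yy' : y - y' = (w - y') - (w - y) by rewrite opprB [RHS]addrC addrA subrK.
by apply/andP; split; [rewrite yy' rpredB|rewrite rpredB].
Qed.

Lemma exists_foot W : opposite A Z W -> ~ opposite A Z (W :&: orth <[w]>)%VS ->
  exists y, foot W y.
Proof.
move=> [isoW AW ZW] nopp; have [x] : exists2 x, x \in (Z :&: orth (W :&: orth <[w]>))%VS & x != 0.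
  apply: contrapT => none; apply: nopp; split; first exact: isotropicS (capvSl _ _) isoW.
    by rewrite subv_cap AW sub_orth_line.
  apply/eqP; rewrite -subv0; apply/subvP => x xZ; rewrite memv0; apply: contrapT => /negP x0.
  by apply: none; exists x.
rewrite memv_cap => /andP[xZ /(subv_memv (orth_cap_orth_line _ _))].
move=> /memv_addP[y yW [_ /vlineP[c ->] xE]] x0.
have c0 : c != 0.
  by apply: contraNneq x0 => c0; rewrite -memv0 -ZW memv_cap xZ xE c0 scale0r addr0.
have wE : w - c^-1 *: x = - c^-1 *: y.
  by rewrite xE scalerDr scalerA mulVf // scale1r opprD addrCA subrr addr0 scaleNr.
exists (- c^-1 *: y); split; last first.
- by rewrite -wE -subr_eq0 addrAC subrr add0r oppr_eq0 scaler_eq0 invr_eq0 negb_or c0.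
- exact: memvZ.
by rewrite -wE opprB addrC subrK memvZ.
Qed.

Lemma foot_not_opposite_cap W y : foot W y -> ~ opposite A Z (W :&: orth <[w]>)%VS.
Proof.
move=> [wyZ yW yw] [_ _ ZW]; case/eqP: yw; apply/esym/eqP.
rewrite -subr_eq0 -memv0 -ZW memv_cap wyZ.
apply/orthP => v; rewrite memv_cap mem_orth_line => /andP[vW /eqP wv].
by rewrite omegaBr (orth_omega yW vW) (omega_eq0C wv) subrr.
Qed.

Lemma foot_notin y : w - y \in Z -> y \notin (A + form_kernel)%VS.
Proof.
move=> wyZ; apply: contra zw => /memv_addP[a aA [k kK yE]].
have omega_y v : v \in orth A -> om v y = 0.
  by move=> vA; rewrite yE omegaDr (kernel_omega _ kK) addr0; exact: orth_omegaC vA aA.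
move: wyZ; rewrite -{1}defZ => /memv_addP[z' z'Z' [_ /vlineP[c ->] wyE]].
have zZ : z \in Z by rewrite -defZ memv_addr_line.
have wE : w = z' + c *: z + y by rewrite -wyE subrK.
have c0 : c = 0.
  have : om w w = 0 by exact: omega_self.
  rewrite {2}wE !omegaDr omegaZr omega_y // (orth_omegaC wZ' z'Z') add0r addr0 => /eqP.
  by rewrite mulf_eq0 => /orP[/eqP/omega_eq0C/eqP|/eqP//]; rewrite (negPf zw).
rewrite wE c0 scale0r addr0 omegaDr omega_y ?(subv_memv ZA) // addr0.
by rewrite (orth_omegaC (subv_memv ZZ' zZ) z'Z').
Qed.

Definition off_foot : set {vspace E} :=
  [set W | opposite A Z W /\ forall y, foot W y -> y \notin (W + form_kernel)%VS].

Lemma opposite_cap_orth_off_foot : opposite_cap_orth A Z w `<=` off_foot.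
Proof. by move=> W [oppW oppWw]; split=> // y /foot_not_opposite_cap. Qed.

Lemma opposite_nsub V : opposite A Z V -> ~~ (V <= A)%VS.
Proof.
move=> [_ _ ZV]; apply/negP => VA; case/eqP: zw; apply: omega_eq0C.
suff -> : z = 0 by exact: omega0r.
apply/eqP; rewrite -memv0 -ZV memv_cap -{1}defZ memv_addr_line.
by apply: subv_memv (subv_trans ZA (orthS VA)) _; rewrite -defZ memv_addr_line.
Qed.

Lemma opposite_supplements_constructible V L : opposite A Z V -> ~~ (L <= A)%VS ->
  vconstructible (\dim V - \dim A - \dim Z) (supplements A V (V :&: orth Z) L).
Proof.
move=> [_ AV ZV] LA; have -> : (\dim V - \dim A - \dim Z = \dim (V :&: orth Z) - \dim A)%N.
  by have := dim_opposite ZV; clear; lia.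
by apply: supplements_constructible; rewrite ?capvSl // subv_cap AV sub_orthC.
Qed.

Lemma off_foot_below V y : off_foot V -> foot V y ->
  [set W | off_foot W /\ lt W V] = supplements A V (V :&: orth Z) V.
Proof.
move=> [oppV offV] yV; rewrite -(opposite_below oppV).
apply/seteqP; split=> W /=; first by move=> [[oppW _] WV].
move=> [oppW WV]; have leWV : (W <= V)%VS by case/andP: WV.
split=> //; split=> // y' y'W; rewrite (foot_unique oppW y'W (footS leWV yV)).
by apply: contra (offV y yV); apply: subv_memv; exact: addvS.
Qed.

Lemma opposite_cap_above V y : opposite A Z V -> foot V y -> y != 0 ->
  [set W | opposite_cap_orth A Z w W /\ lt V W] = opposite V <[y]>.
Proof.
move=> oppV yV y0; apply/seteqP; split=> W /=.
  move=> [[[isoW AW ZW] oppWw] /andP[VW _]]; split=> //; apply/(line_cap0 _ y0)/negP => yW.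
  by apply: foot_not_opposite_cap oppWw; case: yV => wyZ _ yw; split; [exact: wyZ|exact: yW|].
move=> [isoW VW /(line_cap0 _ y0) yW]; have oppW := opposite_up oppV isoW VW; split.
  split=> //; apply: contrapT => /(exists_foot oppW)[y' y'W].
  by case/negP: yW; rewrite (foot_unique oppV yV (footS VW y'W)); case: y'W.
rewrite plt_vspace VW; apply: contra yW => WV.
by case: yV => _ yV _; exact: subv_memv (orthS WV) yV.
Qed.

Lemma off_foot_below_line V t k :
  opposite A Z V -> foot V (t + k) -> t \in V -> k \in form_kernel ->
  [set W | off_foot W /\ lt W V] = supplements A V (V :&: orth Z) <[t]>.
Proof.
move=> oppV yV tV kK; have [isoV _ _] := oppV.
have off_footE W : opposite A Z W -> (W <= V)%VS -> off_foot W <-> t \notin W.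
  move=> oppW WV; have yW := footS WV yV; have [_ AW _] := oppW.
  have memE : (t + k \in (W + form_kernel)%VS) = (t \in W).
    by apply: mem_add_kernel isoV _ WV tV kK => v /radA; exact: subv_memv AW.
  rewrite -memE; split=> [[_ offW]|yWK]; first exact: offW.
  by split=> // y' y'W; rewrite (foot_unique oppW y'W yW).
have belowE := opposite_below oppV; apply/seteqP; split=> W /=.
  move=> [offW WV]; have [oppW _] := offW; have leWV : (W <= V)%VS by case/andP: WV.
  have [AW _ nWV WVZ _] : supplements A V (V :&: orth Z) V W by rewrite -belowE.
  by split=> //; rewrite -memvE; exact/off_footE.
move=> [AW WV nWV WVZ]; rewrite -memvE => tW.
have [oppW ltWV] : [set W | opposite A Z W /\ lt W V] W.
  by rewrite belowE; split=> //; apply: contra nWV => VW; rewrite eqEsubv WV.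
by split=> //; exact/off_footE.
Qed.

Section AttachFeet.
Variable N : nat.
Hypothesis dN : (N + \dim A + \dim Z <= (\dim M).+1)%N.
Hypothesis line_constructible : forall V y, iso V -> (A <= V)%VS -> ~~ (V <= A)%VS ->
  y \in orth V -> y \notin (V + form_kernel)%VS ->
  vconstructible (\dim M - \dim V) (opposite V <[y]>).

Let link_dim V : opposite A Z V -> (N.-1 <= (\dim V - \dim A - \dim Z) + (\dim M - \dim V))%N.
Proof.
move=> oppV; case: (oppV) => [isoV AV ZV]; have := maxM.2 V isoV.
have := dim_opposite ZV; have : (\dim A <= \dim (V :&: orth Z))%N.
  by apply: dimvS; rewrite subv_cap AV sub_orthC.
by move: dN; clear; lia.
Qed.

Lemma off_foot_constructible :
  vconstructible N (opposite_cap_orth A Z w) -> vconstructible N off_foot.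
Proof.
move=> cap_constructible.
apply: (constructible_attach_up (@vspace_ranked _ E) opposite_cap_orth_off_foot cap_constructible).
move=> V offV nV; have [oppV offV'] := offV; have [isoV AV _] := oppV.
have [y yV] : exists y, foot V y by apply: exists_foot => // oppVw; apply: nV.
have yVK := offV' y yV; have y0 : y != 0 by apply: contraNneq yVK => ->; exact: mem0v.
exists (\dim V - \dim A - \dim Z)%N, (\dim M - \dim V)%N; split; first exact: link_dim.
  rewrite (off_foot_below offV yV).
  by apply: opposite_supplements_constructible; rewrite ?opposite_nsub.
rewrite (opposite_cap_above oppV yV y0); apply: line_constructible; rewrite ?opposite_nsub //.
by case: yV.
Qed.

Lemma off_foot_opposite_constructible :
  vconstructible N off_foot -> vconstructible N (opposite A Z).
Proof.
move=> c_off; apply: (constructible_attach_down (@vspace_ranked _ E) _ c_off); first by move=> W [].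
move=> V oppV nV; have [isoV AV _] := oppV.
have [y [yV yVK]] : exists y, foot V y /\ y \in (V + form_kernel)%VS.
  apply: contrapT => none; apply: nV; split=> // y yV; apply/negP => yVK.
  by apply: none; exists y.
move: yVK => /memv_addP[t tV [k kK yE]]; rewrite yE in yV.
have tA : t \notin A.
  by case: yV => /foot_notin + _ _; apply: contra => tA; exact: memv_add.
exists (\dim V - \dim A - \dim Z)%N, (\dim M - \dim V)%N; split; first exact: link_dim.
  rewrite (off_foot_below_line oppV yV tV kK).
  by apply: opposite_supplements_constructible; rewrite // -memvE.
by rewrite (opposite_above oppV); apply: iso_above_constructible; rewrite // subnK // maxM.2.
Qed.

Lemma opposite_step_constructible :
  vconstructible N (opposite (A + <[w]>) Z') -> vconstructible N (opposite A Z).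
Proof.
move=> cAw; apply/off_foot_opposite_constructible/off_foot_constructible => //.
apply: opposite_cap_orth_constructible => //; rewrite -defZ opposite_add_line //.
by rewrite orth_add subv_cap (subv_trans _ ZA) -?defZ ?addvSl // sub_orth_line.
Qed.

End AttachFeet.

End OppositeStep.

Lemma isotropic_off_orth A z : iso A -> above_radical A -> (\dim A < \dim M)%N ->
  z \notin (A + form_kernel)%VS ->
  exists w, [/\ w \in orth A, Qz w & om z w != 0].
Proof.
move=> isoA radA dA zAK; have [p [pA Qp npA]] := isotropic_extend maxM.1 dA.
have [zp|zp] := eqVneq (om z p) 0; last by exists p.
have pAK : p \notin (A + form_kernel)%VS.
  have isoAp := isotropic_addv_line isoA Qp pA.
  rewrite -(addr0 p) (mem_add_kernel isoAp radA (addvSl _ _)) ?memv_addr_line ?mem0v //.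
have [v vA zv] := exists_orth_omega zAK; have [u uA pu] := exists_orth_omega pAK.
have [x [xA zx px]] : exists x, [/\ x \in orth A, om z x != 0 & om p x != 0].
  have [zu|zu] := eqVneq (om z u) 0; last by exists u.
  have [pv|pv] := eqVneq (om p v) 0; last by exists v.
  by exists (v + u); split; [rewrite rpredD|rewrite omegaDr zu addr0|rewrite omegaDr pv add0r].
have [c Qc] := isotropize Qp px.
by exists (x + c *: p); split; [rewrite rpredD ?memvZ| |rewrite omegaDr omegaZr zp mul0r addr0].
Qed.

Lemma opposite_line_constructible A z : iso A -> above_radical A -> z \in orth A ->
  z \notin (A + form_kernel)%VS -> vconstructible (\dim M - \dim A) (opposite A <[z]>).
Proof.
have [n] := ubnP (\dim M - \dim A)%N; elim: n A z => // n IH A z dn isoA radA zA zAK.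
have [dA|dA] := leqP (\dim M) (\dim A).
  by have -> : (\dim M - \dim A = 0)%N by [apply/eqP]; exact: constructible0.
have [w [wA Qw zw]] := isotropic_off_orth isoA radA dA zAK.
have z0 : z != 0 by apply: contraNneq zAK => ->; exact: mem0v.
have AzM : ((\dim M - \dim A) + \dim A + \dim <[z]> <= (\dim M).+1)%N.
  by rewrite dim_vline z0 addn1 subnK // ltnW.
apply: (opposite_step_constructible (Z' := 0%VS) radA _ _ _ wA _ Qw zw AzM);
  rewrite ?orth0 ?subvf ?memvf ?add0v -?memvE //.
  move=> V y isoV AV nVA yV yVK; apply: IH => //; last by move=> v /radA; exact: subv_memv AV.
  by have := ltn_dimv AV nVA; move: dn dA; clear; lia.
apply: (constructible_min _ (v := (A + <[w]>)%VS)) => [|W []//].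
by split=> //; [exact: isotropic_addv_line|exact: cap0v].
Qed.

Lemma exists_isotropic_dual A Z Z' z : iso Z -> (Z <= orth A)%VS ->
  (Z :&: (A + form_kernel) = 0)%VS -> (Z' <= Z)%VS -> z \in Z -> z \notin Z' ->
  exists w, [/\ w \in orth A, w \in orth Z', Qz w & om z w != 0].
Proof.
move=> isoZ ZA ZAK Z'Z zZ zZ'; have [_ QZ] := isoZ.
have [v vAZ' zv] : exists2 v, v \in orth (A + Z') & om z v != 0.
  apply: exists_orth_omega; apply/negP; rewrite -addvA (addvC Z') addvA.
  move=> /memv_addP[x xAK [z' z'Z' zE]]; case/negP: zZ'.
  have xZ : x \in Z by rewrite -(addrK z' x) -zE rpredB // (subv_memv Z'Z).
  have : x \in (Z :&: (A + form_kernel))%VS by rewrite memv_cap xZ.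
  by rewrite zE ZAK memv0 => /eqP ->; rewrite add0r.
have [c Qw] := isotropize (QZ z zZ) zv; exists (v + c *: z).
move: vAZ'; rewrite orth_add memv_cap => /andP[vA vZ']; split=> //.
- by rewrite rpredD ?memvZ // (subv_memv ZA).
- by rewrite rpredD ?memvZ // (subv_memv _ zZ) // (subv_trans (isotropic_sub_orth isoZ)) // orthS.
- by rewrite omegaDr omegaZr (omega_self (QZ z zZ)) mul0r addr0.
Qed.

Lemma cap_add_line_kernel A Z z w : z \in orth A -> z \in orth Z -> om z w != 0 ->
  (Z :&: (A + form_kernel) = 0)%VS -> (Z :&: (A + <[w]> + form_kernel) = 0)%VS.
Proof.
move=> zA zZ zw ZAK; apply/eqP; rewrite -subv0 -ZAK subv_cap capvSl; apply/subvP => x.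
rewrite memv_cap => /andP[xZ /memv_addP[_ /memv_addP[a aA [_ /vlineP[c ->] ->]] [k kK xE]]].
have := orth_omegaC zZ xZ; rewrite xE !omegaDr omegaZr (kernel_omega _ kK) (orth_omegaC zA aA).
rewrite addr0 add0r => /eqP; rewrite mulf_eq0 (negPf zw) => /eqP ->.
by rewrite scale0r addr0 memv_add.
Qed.

Lemma opposite_constructible A Z : iso A -> above_radical A -> iso Z -> (Z <= orth A)%VS ->
  (Z :&: (A + form_kernel) = 0)%VS ->
  vconstructible ((\dim M).+1 - (\dim A + \dim Z)) (opposite A Z).
Proof.
have [n] := ubnP (\dim Z); elim: n A Z => // n IH A Z dn isoA radA isoZ ZA ZAK.
have [dAZ|dAZ] := leqP (\dim M).+1 (\dim A + \dim Z).
  by have -> : ((\dim M).+1 - (\dim A + \dim Z) = 0)%N by [apply/eqP]; exact: constructible0.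
have [Z0|Z0] := eqVneq Z 0%VS.
  by apply: (constructible_min _ (v := A)) => [|W []//]; split=> //; rewrite Z0 cap0v.
have /subvPn[z zZ z0] : ~~ (Z <= 0)%VS by rewrite subv0.
have [Z' [hypZ' _ zZ']] := exists_hyperplane_avoiding (sub0v Z) zZ z0.
have [Z'Z /eqP dZ] := andP hypZ'.
have defZ : (Z' + <[z]>)%VS = Z by apply: hyperplane_add; rewrite // -memvE.
have ZZ' : (Z <= orth Z')%VS by apply: subv_trans (isotropic_sub_orth isoZ) (orthS Z'Z).
have [w [wA wZ' Qw zw]] := exists_isotropic_dual isoZ ZA ZAK Z'Z zZ zZ'.
apply: (opposite_step_constructible radA ZA defZ ZZ' wA wZ' Qw zw).
- by rewrite -addnA subnK // ltnW.
- move=> V y isoV AV _ yV yVK; apply: opposite_line_constructible => // u /radA.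
  exact: subv_memv AV.
have dAw := leq_dim_addv_line A w; apply: (constructible_le _ (IH (A + <[w]>)%VS Z' _ _ _ _ _ _)).
- by move: dAw dZ; clear; lia.
- by move: dZ dn; clear; lia.
- exact: isotropic_addv_line.
- by move=> u /radA; exact: subv_memv (addvSl _ _).
- exact: isotropicS isoZ.
- by rewrite orth_add subv_cap (subv_trans Z'Z ZA) sub_orth_line.
apply: (@cap_add_line_kernel A Z' z w) => //; [exact: subv_memv ZA zZ|exact: subv_memv ZZ' zZ|].
by apply/eqP; rewrite -subv0 -ZAK capvS.
Qed.

Section Saturation.
Variables A Z : {vspace E}.
Hypotheses (isoA : iso A) (radA : above_radical A) (isoZ : iso Z) (ZA : (Z <= orth A)%VS).
Hypothesis ZAK : (Z :&: (A + form_kernel) = 0)%VS.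

Lemma dim_add_max : (\dim A + \dim Z <= \dim M)%N.
Proof.
rewrite -dimv_disjoint_sum ?maxM.2 //; first exact: isotropic_addv.
by apply/eqP; rewrite capvC -subv0 -ZAK capvS // addvSl.
Qed.

Lemma opposite_dim W : opposite A Z W -> (\dim A + \dim Z <= \dim W < (\dim M).+1)%N.
Proof.
move=> [isoW AW ZW]; rewrite ltnS maxM.2 // andbT -(dim_opposite ZW) leq_add2r dimvS //.
by rewrite subv_cap AW sub_orthC.
Qed.

Lemma opposite_extend W d : opposite A Z W -> (\dim W <= d <= \dim M)%N ->
  exists W', [/\ opposite A Z W', (W <= W')%VS & \dim W' = d].
Proof.
have [n] := ubnP (d - \dim W)%N; elim: n W => // n IH W dn oppW /andP[Wd dM].
have [Wd'|ne] := eqVneq (\dim W) d; first by exists W.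
have ltWd : (\dim W < d)%N by rewrite ltn_neqAle ne.
have [isoW _ _] := oppW; have [|v [vW Qv nvW]] := isotropic_extend maxM.1 (W := W).
  exact: leq_trans ltWd dM.
have [|||W' [oppW' WvW' dW']] := IH (W + <[v]>)%VS.
- by rewrite dim_addv_line //; move: dn ltWd; clear; lia.
- by apply: (opposite_up oppW); [exact: isotropic_addv_line|exact: addvSl].
- by rewrite dim_addv_line // ltWd.
by exists W'; split=> //; exact: subv_trans (addvSl _ _) WvW'.
Qed.

Lemma opposite_restrict W d : opposite A Z W -> (\dim A + \dim Z <= d <= \dim W)%N ->
  exists W', [/\ opposite A Z W', (W' <= W)%VS & \dim W' = d].
Proof.
move=> oppW /andP[ld dW]; have [isoW AW ZW] := oppW; pose W0 := (A + (W :\: orth Z))%VS.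
have W0W : (W0 <= W)%VS by rewrite subv_add AW diffvSl.
have dW0 : (\dim W0 <= \dim A + \dim Z)%N.
  have := dimv_sum_cap A (W :\: orth Z)%VS; have := dimv_cap_compl W (orth Z).
  by have := dim_opposite ZW; rewrite -/W0; clear; lia.
have [|W' [W0W' W'W dW']] := subspace_between W0W (d := d).
  by rewrite (leq_trans dW0 ld).
exists W'; split=> //; have [->//|neW] := eqVneq W' W.
suff [] : [set X | opposite A Z X /\ lt X W] W' by [].
rewrite (opposite_below oppW); split; [|exact: W'W|exact: neW| |].
- exact: subv_trans (addvSl _ _) W0W'.
- apply/eqP; rewrite eqEsubv subv_add W'W capvSl /= -{1}(addv_diff_cap W (orth Z)).
  by rewrite addvS // (subv_trans (addvSr A _)).
- by apply: contra neW => WW'; rewrite eqEsubv W'W.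
Qed.

Lemma opposite_saturated :
  saturated (@vsub_le F E) (fun W => \dim W) (opposite A Z) (\dim A + \dim Z) (\dim M).+1.
Proof.
have [W0 oppW0] : exists W, opposite A Z W.
  by apply: constructible_nonempty (opposite_constructible isoA radA isoZ ZA ZAK);
    rewrite subn_gt0 ltnS dim_add_max.
split=> [W|]; first exact: opposite_dim.
case=> [|a|] [|b|] //= oppa oppb ab d /andP[ad db]; rewrite ?ltnS in db;
  try by move: ad db; clear; lia.
- have [|W [oppW Wb dW]] := opposite_restrict (d := d) oppb; first by rewrite ad ltnW.
  by exists W; rewrite // open_interval_BotMid; split=> //; apply: plt_dimv; rewrite ?dW.
- rewrite open_interval_BotTop; have [le_d|lt_d] := leqP d (\dim W0).
    by have [|W [oppW _ dW]] := opposite_restrict (d := d) oppW0; [rewrite ad|exists W].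
  by have [|W [oppW _ dW]] := opposite_extend (d := d) oppW0; [rewrite ltnW|exists W].
- have [|W [aW Wb dW]] := subspace_between ab (d := d); first by rewrite ltnW // ltnW.
  have isoW : iso W by case: oppb => isob _ _; exact: isotropicS isob.
  exists W; rewrite // open_interval_MidMid; split; first exact: opposite_up oppa isoW aW.
  by split; apply: plt_dimv; rewrite ?dW.
- have [|W [oppW aW dW]] := opposite_extend (d := d) oppa; first by rewrite ltnW.
  by exists W; rewrite // open_interval_MidTop; split=> //; apply: plt_dimv; rewrite ?dW.
Qed.

Lemma opposite_cohen_macaulay : cohen_macaulay (@vsub_le F E) (opposite A Z).
Proof.
apply: (saturated_cohen_macaulay (@vspace_ranked _ E) opposite_saturated).
have [_ letr lea _ _] := @vspace_ranked F E.
case=> [|a|] [|b|] //= oppa oppb ab; rewrite ?subnn; try exact: constructible0.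
- rewrite open_interval_BotMid // (opposite_below oppb) subnDA; have [isob Ab Zb] := oppb.
  have [bA|bA] := boolP (b <= A)%VS; last exact: opposite_supplements_constructible.
  by have /eqP -> := dimvS bA; exact: constructible0.
- by rewrite open_interval_BotTop; exact: opposite_constructible.
- rewrite subnS open_interval_MidMid (_ : [set W | _] = between a b).
    exact: between_constructible.
  apply/seteqP; split=> W /=; first by move=> [_ [aW Wb]].
  move=> [aW Wb]; split=> //; have [[/andP[leaW _] /andP[leWb _]] [isob _ _]] := (conj aW Wb, oppb).
  by apply: (opposite_up oppa) leaW; exact: isotropicS leWb isob.
- rewrite open_interval_MidTop subSS (opposite_above oppa); have [isoa _ _] := oppa.
  by apply: iso_above_constructible; rewrite // subnK // maxM.2.
Qed.

End Saturation.

End MaximalIsotropic.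
End Stable.

Lemma perp_orth U v : perp sigma eps q U v <-> v \in orth U.
Proof. by split=> [Uv|vU u uU]; [apply/orthP => u /Uv/omega_eq0C|exact: orth_omegaC vU uU]. Qed.

Lemma add_perp_full U W :
  (forall e, exists w x, [/\ w \in W, perp sigma eps q U x & e = w + x]) <->
  (W + orth U)%VS = fullv.
Proof.
split=> [WU|WU e]; last first.
  have /memv_addP[w wW [x xU ->]] : e \in (W + orth U)%VS by rewrite WU memvf.
  by exists w, x; split=> //; exact/perp_orth.
apply/eqP; rewrite eqEsubv subvf; apply/subvP => e _; have [w [x [wW /perp_orth xU ->]]] := WU e.
exact: memv_add.
Qed.

Lemma orth_diff_kernel U : orth (U :\: form_kernel) = orth U.
Proof.
rewrite -[in RHS](addv_diff_cap U form_kernel) orth_add; apply/esym/capv_idPl.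
exact/sub_orth_kernel/capvSr.
Qed.

Lemma Rad_cap_kernel U v : iso U -> above_radical U ->
  Rad sigma eps Lambda q v <-> v \in (U :&: form_kernel)%VS.
Proof.
move=> [_ QU] radU; rewrite memv_cap; split=> [radv|/andP[vU /kernelP vK]]; last first.
  by split=> //; exact: QU.
by rewrite radU //=; apply/kernelP; case: radv.
Qed.

Lemma PomegaU_opposite U : Pomega sigma eps Lambda q U ->
  PomegaU sigma eps Lambda q U = opposite (U :&: form_kernel) (U :\: form_kernel).
Proof.
move=> [isoU radU [u0 u0U nrad_u0] _]; have radE v := Rad_cap_kernel v isoU radU.
set Z := (U :\: form_kernel)%VS; have ZK : (Z :&: form_kernel = 0)%VS by exact: capv_diff.
have nZK : ~ (Z <= form_kernel)%VS.
  move=> ZK'; apply/nrad_u0/radE; rewrite -(addv_diff_cap U form_kernel) -/Z in u0U.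
  by move: u0U; rewrite -(capv_idPl ZK') ZK add0v.
apply/seteqP; split=> W.
  move=> [[isoW radW _ _] /add_perp_full/eqP]; rewrite -orth_diff_kernel (addv_orth_full _ ZK).
  by move=> /eqP ZW; split=> //; apply/subvP => v /radE/radW.
move=> [isoW KW ZW]; split; last first.
  by apply/add_perp_full/eqP; rewrite -orth_diff_kernel addv_orth_full // ZW.
split=> //; first by move=> v /radE; exact: subv_memv KW.
- apply: contrapT => none; apply: nZK; have WK : (W <= form_kernel)%VS.
    apply/subvP => v vW; apply: contrapT => /negP vK; apply: none; exists v => // /radE.
    by rewrite memv_cap (negPf vK) andbF.
  have /capv_idPl := sub_orth_kernel Z WK; rewrite ZW => <-; exact: sub0v.
- move=> WE; apply: nZK; have := isotropic_sub_orth isoW; rewrite WE; exact: subv_trans (subvf Z).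
Qed.

End Forms.

Section StablePart.
Variables (F : fieldType) (E : vectType F).
Variables (sigma : {rmorphism F -> F}) (eps : F) (Lambda : pred F) (q : E -> E -> F).

(* [Lambda] is not assumed stable under [c |-> sigma a * c * a], but isotropy only depends on
   its largest stable subgroup. *)
Definition stable_part : pred F := fun c => `[< forall a, sigma a * c * a \in Lambda >].

Lemma stable_partP c : c \in stable_part <-> forall a, sigma a * c * a \in Lambda.
Proof. by rewrite unfold_in; split=> /asboolP. Qed.

Lemma stable_part_sub c : c \in stable_part -> c \in Lambda.
Proof. by move/stable_partP/(_ 1); rewrite rmorph1 mul1r mulr1. Qed.

Lemma stable_part_stable a c : c \in stable_part -> sigma a * c * a \in stable_part.
Proof.
move=> /stable_partP Lc; apply/stable_partP => b.
have -> : sigma b * (sigma a * c * a) * b = sigma (a * b) * c * (a * b) by rewrite rmorphM; ring.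
exact: Lc.
Qed.

Lemma stable_part_parameters :
  form_parameters sigma eps Lambda -> form_parameters sigma eps stable_part.
Proof.
move=> [sigmaK epsK LB Lmin Lmax]; split=> //.
- move=> a b /stable_partP La /stable_partP Lb; apply/stable_partP => c.
  by rewrite mulrBr mulrBl; exact: LB.
- move=> c; apply/stable_partP => a.
  have -> : sigma a * (c - eps * sigma c) * a = sigma a * c * a - eps * sigma (sigma a * c * a).
    by rewrite !rmorphM sigmaK; ring.
  exact: Lmin.
- by move=> c /stable_part_sub; exact: Lmax.
Qed.

Lemma isotropic_stable_part : sesquilinear sigma q ->
  isotropic sigma eps stable_part q = isotropic sigma eps Lambda q.
Proof.
move=> [_ _ qZ]; apply/funext => W; apply/propext.
split=> -[om0 Q0]; split=> // v vW; first exact/stable_part_sub/Q0.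
by apply/stable_partP => a; rewrite -qZ; apply: Q0; rewrite memvZ.
Qed.

End StablePart.

Theorem theorem4p7 (F : fieldType) (E : vectType F)
    (sigma : {rmorphism F -> F}) (eps : F) (Lambda : pred F)
    (q : E -> E -> F) :
  form_parameters sigma eps Lambda ->
  sesquilinear sigma q ->
  forall U : {vspace E}, Pomega sigma eps Lambda q U ->
    cohen_macaulay (@vsub_le F E) (PomegaU sigma eps Lambda q U).
Proof.
move=> params sesq U PU; have [isoU radU _ _] := PU.
have stable_params := stable_part_parameters params.
have isoE := isotropic_stable_part eps Lambda sesq.
have radE v := Rad_cap_kernel params sesq v isoU radU.
have [M isoM leM] := exists_max_dim isoU.
rewrite (PomegaU_opposite params sesq PU) /opposite -isoE.
set K := form_kernel sigma eps q; rewrite -isoE in isoU isoM leM.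
have UK : (U :&: K <= U)%VS by exact: capvSl.
apply: (opposite_cohen_macaulay stable_params sesq (@stable_part_stable _ _ _) (conj isoM leM)).
- exact: isotropicS UK isoU.
- by move=> v [vK Qv]; apply/radE; split=> //; exact: stable_part_sub Qv.
- exact: isotropicS (diffvSl _ _) isoU.
- exact: (sub_orth_kernel params sesq) (capvSr _ _).
by rewrite (addv_idPr (capvSr _ _)) capv_diff.
Qed.
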